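(* Let $\alpha=(A_+,A_-,D)$ be a T-datum of size $r$. If $\alpha$ is of finite type, then there exists a vector $v\in\mathbb{R}^r$ with $v>0$ such that $\mathring{A}_+^{\mathsf T}v>0$ and $\mathring{A}_-^{\mathsf T}v>0$, where $\mathring{A}_\pm=A_\pm|_{z=1}$ and, for a vector $w$, $w>0$ means that all components of $w$ are positive.
   Context: Notation: $[1,r]=\{1,\dots,r\}$; $\mathfrak{S}_r$ is the group of permutations of $[1,r]$; $\delta$ is the Kronecker delta. For a square matrix $A$ with entries in $\mathbb{Z}[z^{\pm1}]$, $A^\dagger:=(A|_{z=z^{-1}})^{\mathsf T}$. T-datum: consider triples $(N_0,N_+,N_-)$ of matrices in $\mathrm{Mat}_{r\times r}(\mathbb{Z}[z])$, $N_\varepsilon=(\sum_{p\ge0}n^\varepsilon_{ab;p}z^p)_{a,b\in[1,r]}$, satisfying (N1) $n^0_{ab;p}=\delta_{ab}\delta_{p0}+\delta_{a\sigma(b)}\delta_{pp_a}$ for some $\sigma\in\mathfrak{S}_r$ and $p_a\in\mathbb{Z}_{>0}$; (N2) $n^\pm_{ab;p}\ge0$ for all $a,b,p$; (N3) $n^\pm_{ab;p}=0$ unless $0<p<p_a$; (N4) $n^+_{ab;p}n^-_{ab;p}=0$ for all $a,b,p$. A T-datum of size $r$ is a triple $\alpha=(A_+,A_-,D)$ such that $A_\pm=N_0-N_\pm$ for some $(N_0,N_+,N_-)$ satisfying (N1)-(N4) (this triple is uniquely determined by $(A_+,A_-)$) and $D$ is a positive integer diagonal matrix with $N_0D=DN_0$,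 $D^{-1}N_\pm D\in\mathrm{Mat}_{r\times r}(\mathbb{Z}[z])$, and $A_+DA_-^\dagger=A_-DA_+^\dagger$. T-algebra: $\mathscr{T}(\alpha)$ is the commutative ring generated by indeterminates $T_a(u)^{\pm1}$, $(a,u)\in[1,r]\times\mathbb{Z}$, subject to $T_a(u)T_a(u)^{-1}=1$ and, for all $(a,u)$, $$\prod_{b=1}^{r}\prod_{p\ge0}T_b(u+p)^{n^0_{ba;p}}=\prod_{b=1}^{r}\prod_{p\ge0}T_b(u+p)^{n^+_{ba;p}}+\prod_{b=1}^{r}\prod_{p\ge0}T_b(u+p)^{n^-_{ba;p}}.$$ $\mathscr{T}^\circ(\alpha)$ is the subring generated by all $T_a(u)$. The T-datum $\alpha$ is of finite type if $\{T_a(u)\in\mathscr{T}^\circ(\alpha)\mid(a,u)\in[1,r]\times\mathbb{Z}\}$ is a finite set. *)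

(* Defs.v *)
From HB Require Import structures.
From mathcomp Require Import all_boot all_order all_fingroup all_algebra.
From mathcomp Require Import generic_quotient ring_quotient fraction.
From mathcomp Require Import multinomials.monalg.
From mathcomp Require Import boolp classical_sets cardinality reals.

Set Implicit Arguments.
Unset Strict Implicit.
Unset Printing Implicit Defensive.

Import Order.TTheory GRing.Theory Num.Theory.

Local Open Scope ring_scope.

(* The Laurent polynomial ring Z[z, z^-1] is realized inside Frac(Z[z]); only  *)
(* matrices over Z[z] need a dagger.                                           *)
Definition tofracpoly (p : {poly int}) : {fraction {poly int}} := FracField.tofrac p.

Definition subst_zinv (p : {poly int}) : {fraction {poly int}} :=
  (map_poly (fun c : int => c%:~R) p).[(tofracpoly 'X)^-1].

Definition dagger n (A : 'M[{poly int}]_n) : 'M[{fraction {poly int}}]_n :=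
  (map_mx subst_zinv A)^T.

Definition fracmx n (A : 'M[{poly int}]_n) : 'M[{fraction {poly int}}]_n :=
  map_mx tofracpoly A.

Definition constmx n (D : 'M[int]_n) : 'M[{poly int}]_n := map_mx polyC D.

Record N_triple (r : nat) := NTriple {
  N0 : 'M[{poly int}]_r;
  Nplus : 'M[{poly int}]_r;
  Nminus : 'M[{poly int}]_r }.

Definition N_conditions r (N : N_triple r) : Prop :=
  exists (sigma : 'S_r) (p_ : 'I_r -> nat),
  [/\ forall a, (0 < p_ a)%N,
      forall a b k, (N0 N a b)`_k =
        (a == b)%:R * (k == 0%N)%:R + (a == sigma b)%:R * (k == p_ a)%:R,
      forall a b k, 0 <= (Nplus N a b)`_k /\ 0 <= (Nminus N a b)`_k,
      forall a b k, ~~ (0 < k < p_ a)%N ->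
        (Nplus N a b)`_k = 0 /\ (Nminus N a b)`_k = 0
    & forall a b k, (Nplus N a b)`_k * (Nminus N a b)`_k = 0].

(* The existential clauses say that D^-1 N_+- D has its entries in Z[z].       *)
Definition D_conditions r (N : N_triple r) (Ap Am : 'M[{poly int}]_r)
    (D : 'M[int]_r) : Prop :=
  let DF := fracmx (constmx D) in
  [/\ is_diag_mx D /\ forall a, 0 < D a a,
      N0 N *m constmx D = constmx D *m N0 N,
      exists M, invmx DF *m fracmx (Nplus N) *m DF = fracmx M,
      exists M, invmx DF *m fracmx (Nminus N) *m DF = fracmx M
    & fracmx Ap *m DF *m dagger Am = fracmx Am *m DF *m dagger Ap].

Record T_datum (r : nat) := TDatum {
  Aplus : 'M[{poly int}]_r;
  Aminus : 'M[{poly int}]_r;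
  Dmx : 'M[int]_r;
  _ : exists N : N_triple r,
    [/\ N_conditions N, Aplus = N0 N - Nplus N, Aminus = N0 N - Nminus N
      & D_conditions N Aplus Aminus Dmx] }.

Lemma T_datumP r (alpha : T_datum r) : exists N : N_triple r,
  [/\ N_conditions N, Aplus alpha = N0 N - Nplus N,
      Aminus alpha = N0 N - Nminus N
    & D_conditions N (Aplus alpha) (Aminus alpha) (Dmx alpha)].
Proof. by case: alpha. Qed.

Lemma N_triple_uniq r (N N' : N_triple r) :
  N_conditions N -> N_conditions N' ->
  N0 N - Nplus N = N0 N' - Nplus N' -> N0 N - Nminus N = N0 N' - Nminus N' ->
  N = N'.
Proof.
have disj (M : N_triple r) : N_conditions M -> forall a b k,
    [/\ 0 <= (N0 M a b)`_k, 0 <= (Nplus M a b)`_k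
      & (N0 M a b)`_k = 0 \/ (Nplus M a b)`_k = 0].
  case=> s [p_ [p_gt0 M1 M2 M3 M4]] a b k; split.
  - by rewrite M1 addr_ge0 // mulr_ge0 // ler0n.
  - by case: (M2 a b k).
  - case: (boolP (0 < k < p_ a)%N) => [/andP[k0 kp]|/M3 H].
      by left; rewrite M1 (gtn_eqF k0) (ltn_eqF kp) !mulr0 addr0.
    by right; case: (H b).
move=> hN hN' ep em.
have e0 : N0 N = N0 N'.
  apply/matrixP => a b; apply/polyP => k.
  have := congr1 (fun A : 'M[{poly int}]_r => (A a b)`_k) ep.
  rewrite !mxE !coefB.
  have [x0 y0 xy] := disj _ hN a b k; have [x0' y0' xy'] := disj _ hN' a b k.
  move=> e; apply/eqP; case: xy xy' => H [] H'; move: x0 y0 x0' y0' e;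
    rewrite H H' ?subr0 ?sub0r.
  - by [].
  - move=> _ y0 x0' _ e; rewrite -e eq_sym oppr_eq0 eq_le y0 andbT.
    by rewrite -oppr_ge0 e.
  - move=> x0 _ _ y0' e; rewrite e oppr_eq0 eq_le y0' andbT.
    by rewrite -oppr_ge0 -e.
  - by move=> _ _ _ _ ->.
case: N N' e0 ep em {hN hN'} => [a b c] [a' b' c'] /= -> .
by move=> /addrI /oppr_inj -> /addrI /oppr_inj ->.
Qed.

(* By N_triple_uniq the choice is canonical. *)
Definition T_triple r (alpha : T_datum r) : N_triple r :=
  projT1 (cid (T_datumP alpha)).

Lemma T_tripleP r (alpha : T_datum r) (N := T_triple alpha) :
  [/\ N_conditions N, Aplus alpha = N0 N - Nplus N,
      Aminus alpha = N0 N - Nminus N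
    & D_conditions N (Aplus alpha) (Aminus alpha) (Dmx alpha)].
Proof. exact: (projT2 (cid (T_datumP alpha))). Qed.

(* Unlike the library's idealr_closed, the unit ideal is not excluded.         *)
Definition ideal_closed (A : comNzRingType) (I : {pred A}) : Prop :=
  zmod_closed I /\ forall x y, y \in I -> x * y \in I.

Definition ideal_gen (A : comNzRingType) (G : A -> Prop) : {pred A} :=
  fun x => `[< forall I : {pred A}, ideal_closed I ->
                 (forall y, G y -> y \in I) -> x \in I >].

Definition subring_gen (A : pzRingType) (G : A -> Prop) : {pred A} :=
  fun x => `[< forall S : {pred A}, subring_closed S ->
                 (forall y, G y -> y \in S) -> x \in S >].

Section Presentation.
Variables (A : comNzRingType) (G : A -> Prop).
Local Open Scope quotient_scope.

Lemma ideal_gen_closed : ideal_closed (ideal_gen G).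
Proof.
split; first split.
- by apply/asboolP => I [[]].
- move=> x y /asboolP hx /asboolP hy; apply/asboolP => I hI hG.
  by case: (hI) => -[_ hB] _; apply: hB; [apply: hx | apply: hy].
- move=> x y /asboolP hy; apply/asboolP => I hI hG.
  by case: (hI) => _; apply; apply: hy.
Qed.

Lemma ideal_gen_sub x : G x -> x \in ideal_gen G.
Proof. by move=> Gx; apply/asboolP => I _; apply. Qed.

HB.instance Definition _ :=
  GRing.isZmodClosed.Build A (ideal_gen G) (proj1 ideal_gen_closed).

(* A / (G); ring_quotient.v only gives a ring structure to the quotient by a   *)
(* proper ideal, hence the multiplicative part is set up here.                 *)
Definition quot_gen : Type := Quotient.quot (ideal_gen G).
HB.instance Definition _ := Choice.on quot_gen.
HB.instance Definition _ := GRing.Zmodule.on quot_gen.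
HB.instance Definition _ :=
  EqQuotient.copy quot_gen (Quotient.quot (ideal_gen G)).

Definition quot_pi (x : A) : quot_gen := \pi_quot_gen x.

Lemma quot_pi_surj (x : quot_gen) : exists a, x = quot_pi a.
Proof. by exists (repr x); rewrite /quot_pi reprK. Qed.

Lemma quot_pi_eq (x y : A) :
  reflect (quot_pi x = quot_pi y) (x - y \in ideal_gen G).
Proof. by rewrite Quotient.idealrBE; apply: eqP. Qed.

Definition quot_one : quot_gen := quot_pi 1.
Definition quot_mul (x y : quot_gen) : quot_gen := quot_pi (repr x * repr y).

Lemma quot_piM x y : quot_mul (quot_pi x) (quot_pi y) = quot_pi (x * y).
Proof.
have H z : z - repr (quot_pi z) \in ideal_gen G.
  by apply/quot_pi_eq; rewrite /quot_pi reprK.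
apply/esym/quot_pi_eq; set x' := repr _; set y' := repr _.
have -> : x * y - x' * y' = y * (x - x') + x' * (y - y').
  by rewrite !mulrBr addrA [y * x]mulrC [y * x']mulrC subrK.
by rewrite rpredD //; apply: (proj2 ideal_gen_closed); apply: H.
Qed.

Lemma quot_piD (x y : A) : quot_pi x + quot_pi y = quot_pi (x + y).
Proof. exact/esym/(Quotient.pi_add (ideal_gen G) x y). Qed.

Lemma quot_mulA : associative quot_mul.
Proof.
move=> x y z; case: (quot_pi_surj x) (quot_pi_surj y) (quot_pi_surj z).
by move=> a -> [b ->] [c ->]; rewrite !quot_piM mulrA.
Qed.

Lemma quot_mulC : commutative quot_mul.
Proof.
move=> x y; case: (quot_pi_surj x) (quot_pi_surj y) => a -> [b ->].
by rewrite !quot_piM mulrC.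
Qed.

Lemma quot_mul1 : left_id quot_one quot_mul.
Proof. by move=> x; case: (quot_pi_surj x) => a ->; rewrite quot_piM mul1r. Qed.

Lemma quot_mulDl : left_distributive quot_mul +%R.
Proof.
move=> x y z; case: (quot_pi_surj x) (quot_pi_surj y) (quot_pi_surj z).
by move=> a -> [b ->] [c ->]; rewrite quot_piD !quot_piM quot_piD mulrDl.
Qed.

HB.instance Definition _ := GRing.Zmodule_isComPzRing.Build quot_gen
  quot_mulA quot_mulC quot_mul1 quot_mulDl.

Lemma quot_pi_zmod_morphism : zmod_morphism quot_pi.
Proof.
move=> x y; apply: (canRL (addrK _)).
by rewrite quot_piD subrK.
Qed.

Lemma quot_pi_monoid_morphism : monoid_morphism quot_pi.
Proof. by split=> // x y; rewrite -quot_piM. Qed.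

HB.instance Definition _ :=
  GRing.isZmodMorphism.Build A quot_gen quot_pi quot_pi_zmod_morphism.
HB.instance Definition _ :=
  GRing.isMonoidMorphism.Build A quot_gen quot_pi quot_pi_monoid_morphism.

End Presentation.

Section GeneratedSubring.
Variables (A : comPzRingType) (G : A -> Prop).

Lemma subring_gen_closed : subring_closed (subring_gen G).
Proof.
split.
- by apply/asboolP => S [].
- move=> x y /asboolP hx /asboolP hy; apply/asboolP => S hS hG.
  by case: (hS) => _ hB _; apply: hB; [apply: hx | apply: hy].
- move=> x y /asboolP hx /asboolP hy; apply/asboolP => S hS hG.
  by case: (hS) => _ _ hM; apply: hM; [apply: hx | apply: hy].
Qed.

Lemma subring_gen_sub x : G x -> x \in subring_gen G.
Proof. by move=> Gx; apply/asboolP => S _; apply. Qed.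

HB.instance Definition _ :=
  GRing.isSubringClosed.Build A (subring_gen G) subring_gen_closed.

Record subring_of : Type :=
  SubringOf { subring_val : A; _ : subring_val \in subring_gen G }.
HB.instance Definition _ := [isSub for subring_val].
HB.instance Definition _ := [Choice of subring_of by <:].
HB.instance Definition _ :=
  GRing.SubChoice_isSubComPzRing.Build A (subring_gen G) subring_of
    subring_gen_closed.

End GeneratedSubring.

(* The T-algebra is presented as a quotient of the polynomial ring over Z in   *)
(* the indeterminates indexed by (a, u, e), where e = false stands for T_a(u)  *)
(* and e = true for T_a(u)^-1.                                                 *)
Definition Tindex (r : nat) : choiceType := ('I_r * int * bool)%type.

Definition Tfree (r : nat) : comNzRingType := {malg int[{cmonom (Tindex r)}]}.

Definition Tvar r (a : 'I_r) (u : int) : Tfree r := << ucm ((a, u), false) >>.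

Definition Tvar_inv r (a : 'I_r) (u : int) : Tfree r := << ucm ((a, u), true) >>.

(* The coefficients of N are nonnegative in all uses, so absz is harmless.    *)
Definition Tmonomial r (N : 'M[{poly int}]_r) (a : 'I_r) (u : int) : Tfree r :=
  \prod_(b < r) \prod_(k < size (N b a))
    Tvar b (u + k%:Z) ^+ absz (N b a)`_k.

Definition is_Trelator r (N : N_triple r) (x : Tfree r) : Prop :=
  exists (a : 'I_r) (u : int),
    x = Tvar a u * Tvar_inv a u - 1 \/
    x = Tmonomial (N0 N) a u
        - (Tmonomial (Nplus N) a u + Tmonomial (Nminus N) a u).

Definition T_algebra r (alpha : T_datum r) : comPzRingType :=
  quot_gen (is_Trelator (T_triple alpha)).

Definition T_ r (alpha : T_datum r) (a : 'I_r) (u : int) : T_algebra alpha :=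
  quot_pi (is_Trelator (T_triple alpha)) (Tvar a u).

Definition is_T r (alpha : T_datum r) (x : T_algebra alpha) : Prop :=
  exists a u, x = T_ alpha a u.

Definition T_subalgebra r (alpha : T_datum r) : comPzRingType :=
  subring_of (@is_T r alpha).

Lemma T_in_subalgebra r (alpha : T_datum r) a u :
  T_ alpha a u \in subring_gen (@is_T r alpha).
Proof. by apply: subring_gen_sub; exists a, u. Qed.

Definition Tcirc r (alpha : T_datum r) (a : 'I_r) (u : int) :
  T_subalgebra alpha := SubringOf (T_in_subalgebra alpha a u).

Definition finite_type r (alpha : T_datum r) : Prop :=
  finite_set (range (fun au : 'I_r * int => Tcirc alpha au.1 au.2)).

Definition at1 (R : pzRingType) r (A : 'M[{poly int}]_r) : 'M[R]_r :=
  map_mx (fun p : {poly int} => (p.[1])%:~R) A.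

Definition positive_vec (R : numDomainType) r (w : 'cV[R]_r) : Prop :=
  forall i, 0 < w i 0.

(* Main.v *)
(* A positive real solution of the T-system is a ring homomorphism from the   *)
(* T-algebra to the reals, so under finite type its logarithms L_a(u) take    *)
(* finitely many values. Averaging the T-system over a long time interval     *)
(* turns it into N_0^T v > N_+^T v and N_0^T v > N_-^T v, with a margin that  *)
(* survives a small perturbation of v; hence it suffices that the average v   *)
(* is nonnegative. Start the solution with all initial values 1. The          *)
(* condition A_+ D A_-^dagger = A_- D A_+^dagger says exactly that the        *)
(* T-system is a sequence of mutations of seeds with skew-symmetrizable       *)
(* exchange matrices, so the Laurent phenomenon (after Fomin and Zelevinsky)  *)
(* makes all T_a(u) with u >= 0 positive integers, whence L_a(u) >= 0.        *)

From HB Require Import structures.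
Require Import Defs.
From mathcomp Require Import all_boot all_order all_fingroup all_algebra.
From mathcomp Require Import finmap multinomials.monalg.
From mathcomp Require Import boolp classical_sets cardinality reals.
From mathcomp.analysis Require Import sequences exp.
From mathcomp Require Import zify ring lra.

Set Implicit Arguments.
Unset Strict Implicit.
Unset Printing Implicit Defensive.

Import Order.TTheory GRing.Theory Num.Theory.
Local Open Scope ring_scope.

(** * Laurent polynomials as functions of the logarithms of the variables *)

(** Write a positive real solution as $T_a(u)=e^{L_a(u)}$. The T-system reads
    $L_a(u)+L_{\sigma(a)}(u+p_{\sigma(a)})=\log(e^{x}+e^{y})$, where $x,y$ are the sums of values
    $L_b(u+k)$ weighted by $N_+$ and $N_-$. [log_solution_exists] solves it in both time directions
    from initial values $0$. The solution evaluates the T-algebra, so finite type gives an upper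
    bound $C$ for all $L$ ([log_solution_bounded]).

    Suppose also $L_a(u)\ge 0$ for $u\ge 0$. Then $x,y\ge 0$, and $\log(e^x+e^y)$ exceeds both $x$
    and $y$ by a fixed $d>0$ ([log_sum_exp_gap]). Summed over $m$ consecutive times this gains $md$,
    while dropping the time shifts costs an amount independent of $m$ ([shifted_sum_bound]). So
    $v_b=1+\sum_{u<m}L_b(u)$ works for large $m$ ([eventually_positive_average]).

    The hard part is $L\ge 0$ ([log_solution_ge0]). Listed by time, the steps of the T-system are
    cluster exchanges: [event_symplectic] extracts from the symplectic condition what [chain_word]
    needs to follow the exchange matrix. By the Laurent phenomenon ([laurent_exchanges]) each
    variable is an integral Laurent polynomial in the initial ones. At initial values $1$ it is a
    positive integer, so its logarithm is nonnegative ([chain_log_ge0]).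

    The Laurent phenomenon is proved without unique factorization. Coprimality to $z$ is replaced by
    being a non-zero-divisor modulo $z$ ([nzd_mod]), which suffices to remove a denominator
    ([laurent_clear_denom]); [coprime_exchanges_seed] supplies it. *)

Section LaurentFunctions.
Variables (R : realType) (J : finType).
Implicit Types (g : J -> R) (f h z w q : (J -> R) -> R) (c phi : J -> int).

Definition pairing c g : R := \sum_j (c j)%:~R * g j.

Definition int_linear (l : (J -> R) -> R) := exists c, forall g, l g = pairing c g.

(** The variables are $x_j=e^{g_j}$. As functions of $g$, Laurent polynomials are substituted by
    composition, and monomials are inverted by changing a sign. *)
Definition laurent f := exists s : seq (int * (J -> int)),
  forall g, f g = \sum_(t <- s) t.1%:~R * expR (pairing t.2 g).

Lemma int_linear_coord j : int_linear (fun g => g j).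
Proof.
exists (fun i => (i == j)%:Z) => g; rewrite /pairing (bigD1 j) //= eqxx mul1r.
by rewrite big1 ?addr0 // => i /negPf ->; rewrite mul0r.
Qed.

Lemma int_linearD l1 l2 :
  int_linear l1 -> int_linear l2 -> int_linear (fun g => l1 g + l2 g).
Proof.
move=> [c1 e1] [c2 e2]; exists (fun j => c1 j + c2 j) => g.
by rewrite e1 e2 -big_split /=; apply: eq_bigr => j _; rewrite rmorphD mulrDl.
Qed.

Lemma int_linearZ (n : int) l : int_linear l -> int_linear (fun g => n%:~R * l g).
Proof.
move=> [c e]; exists (fun j => n * c j) => g.
by rewrite e mulr_sumr; apply: eq_bigr => j _; rewrite rmorphM mulrA.
Qed.

Lemma int_linearN l : int_linear l -> int_linear (fun g => - l g).
Proof.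
move=> [c e]; exists (fun j => - c j) => g.
by rewrite e /pairing -sumrN; apply: eq_bigr => j _; rewrite rmorphN mulNr.
Qed.

Lemma int_linear0 : int_linear (fun=> 0).
Proof. by exists (fun=> 0) => g; rewrite /pairing big1 // => j _; rewrite mul0r. Qed.

Lemma int_linear_sum (A : finType) (P : pred A) (F : A -> (J -> R) -> R) :
  (forall i, int_linear (F i)) -> int_linear (fun g => \sum_(i | P i) F i g).
Proof.
move=> /choice [c e]; exists (fun j => \sum_(i | P i) c i j) => g.
under eq_bigr do rewrite e; rewrite exchange_big; apply: eq_bigr => j _.
by rewrite rmorph_sum mulr_suml.
Qed.

Lemma laurent_ext f h : f =1 h -> laurent f -> laurent h.
Proof. by move=> /funext ->. Qed.

Lemma laurent_exp l : int_linear l -> laurent (fun g => expR (l g)).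
Proof. by move=> [c e]; exists [:: (1, c)] => g; rewrite big_seq1 mul1r e. Qed.

Lemma laurent_int (n : int) : laurent (fun=> n%:~R).
Proof.
exists [:: (n, (fun=> 0))] => g; rewrite big_seq1 /pairing big1 ?expR0 ?mulr1 //.
by move=> j _; rewrite mul0r.
Qed.

Lemma laurentD f h : laurent f -> laurent h -> laurent (fun g => f g + h g).
Proof. by move=> [s e] [s' e']; exists (s ++ s') => g; rewrite big_cat /= e e'. Qed.

Lemma laurentM f h : laurent f -> laurent h -> laurent (fun g => f g * h g).
Proof.
move=> [s e] [s' e'].
exists [seq (t.1 * t'.1, (fun j => t.2 j + t'.2 j)) | t <- s, t' <- s'] => g.
rewrite big_allpairs_dep e mulr_suml; apply: eq_bigr => t _.
rewrite e' mulr_sumr; apply: eq_bigr => t' _ /=.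
rewrite rmorphM mulrACA -expRD /pairing -big_split; congr (_ * expR _).
by apply: eq_bigr => j _; rewrite rmorphD mulrDl.
Qed.

Lemma laurentN f : laurent f -> laurent (fun g => - f g).
Proof.
move=> Lf; apply: laurent_ext (laurentM (laurent_int (-1)) Lf) => g.
by rewrite mulN1r.
Qed.

Lemma laurentB f h : laurent f -> laurent h -> laurent (fun g => f g - h g).
Proof. by move=> Lf Lh; apply/laurentD/laurentN. Qed.

Lemma laurentX f n : laurent f -> laurent (fun g => f g ^+ n).
Proof.
move=> Lf; elim: n => [|n IH]; first exact: (laurent_int 1).
by under eq_fun do rewrite exprS; apply: laurentM.
Qed.

Lemma laurent_sum (A : Type) (r : seq A) (F : A -> (J -> R) -> R) :
  (forall i, laurent (F i)) -> laurent (fun g => \sum_(i <- r) F i g).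
Proof.
move=> LF; elim: r => [|i r IH].
  by under eq_fun do rewrite big_nil; apply: (laurent_int 0).
by under eq_fun do rewrite big_cons; apply: laurentD.
Qed.

Lemma laurent_at0 f : laurent f -> exists n : int, f (fun=> 0) = n%:~R.
Proof.
move=> [s ->]; exists (\sum_(t <- s) t.1); rewrite rmorph_sum.
apply: eq_bigr => t _; rewrite /pairing big1 ?expR0 ?mulr1 //.
by move=> j _; rewrite mulr0.
Qed.

(** * Gradings, and non-zero-divisors modulo a Laurent polynomial *)

Definition shift phi (s : R) g : J -> R := fun j => g j + s * (phi j)%:~R.

(** This is the grading in which $x_j$ has degree [phi j], expressed by the flow that scales $x_j$
    by $e^{s\phi_j}$. *)
Definition homogeneous phi (d : int) f :=
  forall g s, f (shift phi s g) = expR (s * d%:~R) * f g.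

Lemma pairing_shift c phi s g :
  pairing c (shift phi s g) = s * (\sum_j c j * phi j)%:~R + pairing c g.
Proof.
rewrite /pairing rmorph_sum mulr_sumr -big_split; apply: eq_bigr => j _ /=.
by rewrite /shift rmorphM; ring.
Qed.

(** Exponentials $e^{sd}$ with distinct $d$ are linearly independent: after a shift of the
    exponents, the values at $s=0,1,2,\dots$ are those of a polynomial at the distinct points $e^s$,
    too many roots for a nonzero one. It serves to separate graded components. *)
Lemma exp_sum_eq0 (A : eqType) (r : seq A) (d : A -> int) (a : A -> R) :
  (forall s : R, \sum_(t <- r) expR (s * (d t)%:~R) * a t = 0) ->
  forall k : int, \sum_(t <- r | d t == k) a t = 0.
Proof.
move=> H k; pose K := (\sum_(t <- r) `|d t| + `|k|)%N.
have rK t : t \in r -> 0 <= d t + K%:Z.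
  by move=> tr; rewrite /K (big_rem t) //=; lia.
pose p : {poly R} := \sum_(t <- r) a t *: 'X^(absz (d t + K%:Z)).
have p0 : p = 0.
  apply/eqP/negP => /negP pn0.
  pose rs := [seq expR (i%:R : R) | i <- iota 0 (size p)].
  have rs_uniq : uniq rs.
    rewrite map_inj_uniq ?iota_uniq // => i j /expR_inj/eqP.
    by rewrite eqr_nat => /eqP.
  suff /(max_poly_roots pn0)/(_ rs_uniq) : all (root p) rs.
    by rewrite size_map size_iota ltnn.
  apply/allP => _ /mapP[i _ ->]; apply/rootP; rewrite horner_sum.
  transitivity (expR (i%:R * K%:R) * \sum_(t <- r) expR (i%:R * (d t)%:~R) * a t).
    rewrite mulr_sumr; apply: eq_big_seq => t /rK dt.
    rewrite hornerZ hornerXn -expRM_natl mulrA -expRD mulrC; congr (expR _ * _).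
    rewrite -mulrDr mulrC; congr (_ * _).
    by rewrite -[X in X = _]/((absz (d t + K%:Z))%:Z%:~R) gez0_abs // rmorphD addrC.
  by rewrite H mulr0.
transitivity (p`_(absz (k + K%:Z))); last by rewrite p0 coef0.
rewrite coef_sum big_mkcond.
apply: eq_big_seq => t /rK dt; rewrite coefZ coefXn.
have kK : 0 <= k + K%:Z by rewrite /K; lia.
have -> : (absz (k + K%:Z) == absz (d t + K%:Z)) = (d t == k) by apply/eqP/eqP; lia.
by case: eqP => _; rewrite ?mulr1 ?mulr0.
Qed.

Definition laurent_multiple z h :=
  exists q, laurent q /\ forall g, h g = z g * q g.

(** This stands for coprimality of [z] and [w]: [w] is not a zero divisor in the quotient of the
    Laurent ring by [z]. *)
Definition nzd_mod z w := forall h, laurent h ->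
  laurent_multiple z (fun g => h g * w g) -> laurent_multiple z h.

(* The component of [h] of lowest degree is divisible by [z], as [w] only     *)
(* contributes higher degrees; subtract it and repeat.                        *)
Lemma nzd_mod_1Dhom_pos phi (dz : int) z (dr : int) w :
  homogeneous phi dz z -> laurent z -> homogeneous phi dr w -> laurent w ->
  0 < dr -> nzd_mod z (fun g => 1 + w g).
Proof.
move=> hz Lz hw Lw dr_gt0 h [s hs].
pose deg (t : int * (J -> int)) := \sum_j t.2 j * phi j.
suff : exists lo n, forall t, t \in s -> lo <= deg t < lo + n%:Z.
  move=> [lo [n]]; elim: n lo s h hs => [|n IH] lo s h hs sdeg [q [Lq hq]].
    exists (fun=> 0); split=> [|g]; first exact: (laurent_int 0).
    rewrite hs mulr0; case: s hs sdeg => [|t s] _ sdeg; first by rewrite big_nil.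
    by have := sdeg t (mem_head _ _); lia.
  have [sq eq] := Lq.
  pose hlo g := \sum_(t <- s | deg t == lo) t.1%:~R * expR (pairing t.2 g).
  pose qlo g := \sum_(t <- sq | deg t + dz == lo) t.1%:~R * expR (pairing t.2 g).
  have Lqlo : laurent qlo.
    by exists [seq t <- sq | deg t + dz == lo] => g; rewrite big_filter.
  have hloE g : hlo g = z g * qlo g.
    pose T : eqType := (int * (J -> int))%type.
    (* The monomials of $h$, of $hw$ and of $-zq$, tagged by origin so that [exp_sum_eq0] can take
       the component of degree [lo] of $h+hw-zq=0$. *)
    pose r : seq (T + (T + T)) := [seq inl t | t <- s] ++ ([seq inr (inl t) | t <- s]
              ++ [seq inr (inr t) | t <- sq]).
    pose d (x : T + (T + T)) :=
      match x with inl t => deg t | inr (inl t) => deg t + dr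
                 | inr (inr t) => deg t + dz end.
    pose a (x : T + (T + T)) : R :=
      match x with inl t => t.1%:~R * expR (pairing t.2 g)
                 | inr (inl t) => t.1%:~R * expR (pairing t.2 g) * w g
                 | inr (inr t) => - (z g * (t.1%:~R * expR (pairing t.2 g))) end.
    have := @exp_sum_eq0 _ r d a _ lo; rewrite !big_cat !big_map /=.
    (* The products with $w$ have degree at least [lo + dr], so none has degree [lo]. *)
    rewrite [X in _ + (X + _)]big1_seq; last first.
      by move=> t /andP[/eqP e ts]; have := sdeg t ts; lia.
    rewrite add0r sumrN -mulr_sumr => H; apply/eqP; rewrite -subr_eq0.
    apply/eqP/H => u; rewrite !big_cat !big_map /=.
    have sumE (s' : seq (int * (J -> int))) :
        \sum_(t <- s') t.1%:~R * expR (pairing t.2 (shift phi u g)) =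
        \sum_(t <- s') expR (u * (deg t)%:~R) * (t.1%:~R * expR (pairing t.2 g)).
      by apply: eq_bigr => t _; rewrite pairing_shift expRD mulrCA.
    have := hq (shift phi u g); rewrite hs eq hw hz !sumE.
    move/eqP; rewrite -subr_eq0 => /eqP e0; rewrite -[RHS]e0 mulrDr mulr1 -addrA.
    congr (_ + _); congr (_ + _).
      rewrite mulr_suml; apply: eq_bigr => t _.
      by rewrite rmorphD mulrDr expRD -/(deg t); ring.
    rewrite mulr_sumr -sumrN; apply: eq_bigr => t _.
    by rewrite rmorphD mulrDr expRD -/(deg t); ring.
  have := IH (lo + 1) [seq t <- s | deg t != lo] (fun g => h g - hlo g).
  case.
  - move=> g; rewrite hs /hlo (bigID (fun t => deg t == lo)) /= big_filter.
    by rewrite addrAC subrr add0r.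
  - by move=> t; rewrite mem_filter => /andP[tlo /sdeg]; move: tlo; lia.
  - exists (fun g => q g - qlo g * (1 + w g)); split.
      by apply: laurentB => //; apply: laurentM => //; apply: laurentD => //;
        apply: (laurent_int 1).
    by move=> g; rewrite mulrBl hq hloE; ring.
  move=> q' [Lq' e']; exists (fun g => q' g + qlo g); split; first exact: laurentD.
  by move=> g; rewrite mulrDr -e' -hloE subrK.
(* A crude window: no single degree exceeds the sum of all absolute values. *)
exists (- (\sum_(t <- s) `|deg t|)%N%:Z), ((\sum_(t <- s) `|deg t|).*2.+1) => t ts.
rewrite (big_rem t) //=; lia.
Qed.

Lemma homogeneousN phi d f :
  homogeneous phi d f -> homogeneous (fun j => - phi j) (- d) f.
Proof.
move=> hf g s; have := hf g (- s); rewrite !rmorphN mulrN mulNr => <-.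
by congr f; apply/funext => j; rewrite /shift rmorphN; ring.
Qed.

(** A negative degree of [w] becomes positive when the grading is reversed. *)
Lemma nzd_mod_1Dhom phi dz z dr w :
  homogeneous phi dz z -> laurent z -> homogeneous phi dr w -> laurent w ->
  dr != 0 -> nzd_mod z (fun g => 1 + w g).
Proof.
move=> hz Lz hw Lw; case: ltrgtP => // [dr_lt0|dr_gt0] _; last first.
  exact: (@nzd_mod_1Dhom_pos phi dz z dr).
apply: (@nzd_mod_1Dhom_pos (fun j => - phi j) (- dz) z (- dr)) => //;
  rewrite ?oppr_gt0 //; exact: homogeneousN.
Qed.

Lemma nzd_modM z w1 w2 : laurent w1 ->
  nzd_mod z w1 -> nzd_mod z w2 -> nzd_mod z (fun g => w1 g * w2 g).
Proof.
move=> Lw1 H1 H2 h Lh hw; apply: H1 => //; apply: H2; first exact: laurentM.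
by case: hw => q [Lq e]; exists q; split=> // g; rewrite -e mulrA.
Qed.

Lemma nzd_mod1 z : nzd_mod z (fun=> 1).
Proof. by move=> h _ [q [Lq e]]; exists q; split=> // g; rewrite -e mulr1. Qed.

Lemma nzd_modX z w n : laurent w -> nzd_mod z w -> nzd_mod z (fun g => w g ^+ n).
Proof.
move=> Lw H; elim: n => [|n IH]; first exact: nzd_mod1.
by under eq_fun do rewrite exprS; apply: nzd_modM.
Qed.

Lemma nzd_mod_exp z l : int_linear l -> nzd_mod z (fun g => expR (l g)).
Proof.
move=> Ll h Lh [q [Lq e]]; exists (fun g => q g * expR (- l g)); split.
  by apply: laurentM => //; apply/laurent_exp/int_linearN.
by move=> g; rewrite mulrA -e -mulrA -expRD subrr expR0 mulr1.
Qed.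

Lemma nzd_modD z w q : laurent q ->
  nzd_mod z w -> nzd_mod z (fun g => w g + z g * q g).
Proof.
move=> Lq H h Lh [p [Lp e]]; apply: H => //.
exists (fun g => p g - h g * q g); split; first by apply: laurentB => //; apply: laurentM.
by move=> g; rewrite mulrBr -e; ring.
Qed.

(** For $a>0$ the product of $w$ with $z^af$ is $z\cdot z^{a-1}(wf)$, a multiple of $z$. Hence $z$
    divides $z^af$, and the exponent $a$ drops by one. *)
Lemma laurent_clear_denom z w f a :
  (forall g, z g != 0) -> laurent z -> laurent w -> nzd_mod z w ->
  laurent (fun g => z g ^+ a * f g) -> laurent (fun g => w g * f g) -> laurent f.
Proof.
move=> z0 Lz Lw H Lzf Lwf; elim: a Lzf => [|a IH] Lzf.
  by apply: laurent_ext Lzf => g; rewrite mul1r.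
have [|q [Lq e]] := H _ Lzf.
  exists (fun g => z g ^+ a * (w g * f g)); split.
    by apply: laurentM => //; apply: laurentX.
  by move=> g; rewrite exprS; ring.
apply: IH; apply: laurent_ext Lq => g; apply: (mulfI (z0 g)).
by rewrite -e exprS mulrA.
Qed.

(** Substituting [Th] creates denominators only through inverses of the new variables, and [W] is a
    common multiple of these variables. *)
Lemma laurent_pullback (Th : (J -> R) -> J -> R) W f : laurent W ->
  (forall j, laurent (fun g => expR (Th g j))) ->
  (forall j, laurent (fun g => W g * expR (- Th g j))) ->
  laurent f -> exists n, laurent (fun g => W g ^+ n * f (Th g)).
Proof.
move=> LW LT LTN [s es].
have mon c (r : seq J) :
    exists n, laurent (fun g => W g ^+ n * expR (\sum_(j <- r) (c j)%:~R * Th g j)).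
  elim: r => [|j r [n IH]].
    exists 0; apply: laurent_ext (laurent_int 1) => g.
    by rewrite big_nil expR0 mulr1.
  have [m Lm] : exists m, laurent (fun g => W g ^+ m * expR ((c j)%:~R * Th g j)).
    case: (c j) => k.
      exists 0; apply: laurent_ext (laurentX k (LT j)) => g.
      by rewrite mul1r -expRM_natl.
    exists k.+1; apply: laurent_ext (laurentX k.+1 (LTN j)) => g.
    by rewrite exprMn -expRM_natl NegzE rmorphN mulrN mulNr.
  exists (m + n)%N; apply: laurent_ext (laurentM Lm IH) => g.
  by rewrite big_cons exprD expRD; ring.
suff [n Ln] : exists n, laurent (fun g => W g ^+ n *
    \sum_(t <- s) t.1%:~R * expR (pairing t.2 (Th g))).
  by exists n; apply: laurent_ext Ln => g; rewrite es.
elim: s {es} => [|t s [n Ln]].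
  exists 0; apply: laurent_ext (laurent_int 0) => g.
  by rewrite big_nil mulr0.
have [m Lm] := mon t.2 (index_enum J); exists (m + n)%N.
apply: (@laurent_ext (fun g => t.1%:~R * W g ^+ n * (W g ^+ m * expR (pairing t.2 (Th g)))
  + W g ^+ m * (W g ^+ n * \sum_(t <- s) t.1%:~R * expR (pairing t.2 (Th g))))).
  by move=> g; rewrite big_cons exprD; ring.
apply: laurentD; apply: laurentM => //; last exact: laurentX.
by apply: laurentM; [apply: laurent_int | apply: laurentX].
Qed.

End LaurentFunctions.

Section LogSumExp.
Variable R : realType.

Definition log_sum_exp (x y : R) : R := ln (expR x + expR y).

Lemma expR_log_sum_exp x y : expR (log_sum_exp x y) = expR x + expR y.
Proof. by rewrite lnK // posrE addr_gt0 ?expR_gt0. Qed.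

Lemma log_sum_expC x y : log_sum_exp x y = log_sum_exp y x.
Proof. by rewrite /log_sum_exp addrC. Qed.

End LogSumExp.

(* [z], [u], [v] are the variables created by exchanging [i], [j], [i] in     *)
(* succession when the exchange matrix has the entries [b.+1] and [- c.+1] at *)
(* [(j, i)] and [(i, j)]; the old variables are the exponentials of [gi] and  *)
(* [gj].                                                                      *)
Section RankTwo.
Variables (R : realType) (J : finType) (phi : J -> int).
Variables (gi gj M N A P M' N' : (J -> R) -> R) (z u v : (J -> R) -> R) (b c : nat).
Definition flow_invariant (l : (J -> R) -> R) :=
  int_linear l /\ forall g s, l (shift phi s g) = l g.
Hypotheses (gi_lin : int_linear gi) (giE : forall g s, gi (shift phi s g) = gi g + s).
Hypotheses (gj_inv : flow_invariant gj) (M_inv : flow_invariant M) (N_inv : flow_invariant N).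
Hypotheses (A_inv : flow_invariant A) (P_inv : flow_invariant P).
Hypotheses (M'_inv : flow_invariant M') (N'_inv : flow_invariant N').
Hypothesis M'E : forall g, M' g = N' g - M g + N g - b.+1%:R * P g.
Hypothesis zE : forall g, z g = (expR (b.+1%:R * gj g + M g) + expR (N g)) * expR (- gi g).
Hypothesis uE : forall g, u g = (z g ^+ c.+1 * expR (A g) + expR (P g)) * expR (- gj g).
Hypothesis vE : forall g, v g * z g = u g ^+ b.+1 * expR (M' g) + expR (N' g).

Let z_neq0 g : z g != 0.
Proof. by rewrite zE mulf_neq0 // gt_eqF ?addr_gt0 ?expR_gt0. Qed.

Let linN (l : (J -> R) -> R) : int_linear l -> int_linear (fun g => - l g).
Proof. exact: int_linearN. Qed.

Let linS n (l : (J -> R) -> R) : int_linear l -> int_linear (fun g => (n%:R : R) * l g).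
Proof. exact: (@int_linearZ R J n). Qed.

Ltac lint := repeat first
  [ exact: gi_lin | exact: gj_inv.1 | exact: M_inv.1 | exact: N_inv.1
  | exact: A_inv.1 | exact: P_inv.1 | exact: M'_inv.1 | exact: N'_inv.1
  | apply: int_linearD | apply: linN | apply: linS ].

Let Lz : laurent z.
Proof.
apply: (laurent_ext (fun g => esym (zE g))); apply: laurentM.
  by apply: laurentD; apply: laurent_exp; lint.
by apply: laurent_exp; lint.
Qed.

(** Modulo [z] only the second monomial of the exchange relation survives, and a monomial is a
    unit. *)
Lemma rank_two_u : laurent u /\ nzd_mod z u.
Proof.
have E g : u g = expR (P g - gj g) + z g * (z g ^+ c * expR (A g - gj g)).
  by rewrite uE exprS !expRD; ring.
have Lq : laurent (fun g => z g ^+ c * expR (A g - gj g)).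
  by apply: laurentM; [apply: laurentX | apply: laurent_exp; lint].
rewrite (funext E); split.
  by apply: laurentD; [apply: laurent_exp; lint | apply: laurentM].
by apply: nzd_modD => //; apply: nzd_mod_exp; lint.
Qed.

Let expand (y t : (J -> R) -> R) m : laurent y -> laurent t ->
  exists r, laurent r /\ forall g, (y g + z g * t g) ^+ m = y g ^+ m + z g * r g.
Proof.
move=> Ly Lt; elim: m => [|m [r [Lr e]]].
  exists (fun=> 0); split; first exact: (laurent_int _ _ 0).
  by move=> g; rewrite mulr0 addr0.
exists (fun g => t g * y g ^+ m + (y g + z g * t g) * r g); split.
  apply: laurentD; apply: laurentM => //; first exact: laurentX.
  by apply: laurentD => //; apply: laurentM.
by move=> g; rewrite exprS e !exprS; ring.
Qed.

(* Modulo [z] the numerator of [v] is a binomial whose terms have degrees [1] *)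
(* and [0] in [gi].                                                           *)
Lemma rank_two_v : laurent v /\ nzd_mod z v.
Proof.
pose y g := expR (P g).
pose t g := z g ^+ c * expR (A g).
have Ly : laurent y by apply: laurent_exp; lint.
have Lt : laurent t by apply: laurentM; [apply: laurentX | apply: laurent_exp; lint].
(* The cofactor of $z$ in $(y+zt)^{b+1}-y^{b+1}$, where $y+zt$ is the numerator of [u]. *)
pose q g := t g * \sum_(i < b.+1) (y g + z g * t g) ^+ (b - i) * y g ^+ i.
have Lq : laurent q.
  apply: laurentM => //; apply: laurent_sum => i.
  apply: laurentM; apply: laurentX => //.
  by apply: laurentD => //; apply: laurentM.
have qE g : (y g + z g * t g) ^+ b.+1 = y g ^+ b.+1 + z g * q g.
  have /eqP := subrXX (y g + z g * t g) (y g) b.+1; rewrite subr_eq => /eqP ->.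
  by rewrite [X in X * _ + _]addrAC subrr add0r /q mulrA addrC.
pose l g := N' g - b.+1%:R * gj g - M g + gi g.
have Ll : int_linear l by rewrite /l; lint.
pose m g := M' g - b.+1%:R * gj g.
have Lm : int_linear m by rewrite /m; lint.
(* By [M'E], the part of the numerator of [v] free of [q] is exactly $e^{l}z$, so the division by
   [z] can be carried out. *)
have v_eq g : v g = expR (l g) + q g * expR (m g).
  apply: (mulIf (z_neq0 g)); rewrite vE uE.
  rewrite exprMn -expRM_natl mulrN.
  have -> : z g ^+ c.+1 * expR (A g) + expR (P g) = y g + z g * t g.
    by rewrite /y /t exprS; ring.
  rewrite qE mulrDl [RHS]mulrDl.
  have -> : expR (l g) * z g = expR (N' g) + expR (N' g - M g + N g - b.+1%:R * gj g).
    rewrite zE mulrDl mulrDr -!expRD /l.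
    by congr (expR _ + expR _); ring.
  have -> : expR (N' g - M g + N g - b.+1%:R * gj g) =
      y g ^+ b.+1 * expR (- (b.+1%:R * gj g)) * expR (M' g).
    by rewrite /y -expRM_natl -!expRD M'E; congr expR; ring.
  by rewrite [m g]/(M' g - _) expRD; ring.
(* Modulo [z], [q] is a multiple of one monomial. If [c] is positive, [z] divides [t] and $k=0$; if
   [c] is zero, all $b+1$ summands of [q] agree modulo [z] and $k=b+1$. *)
have [k [r [Lr kE]]] : exists (k : nat) r, laurent r /\
    forall g, q g = k%:R * expR (A g + b%:R * P g) + z g * r g.
  case: (posnP c) => [c0|c_gt0]; last first.
    exists 0, (fun g => z g ^+ c.-1 * expR (A g) *
      \sum_(i < b.+1) (y g + z g * t g) ^+ (b - i) * y g ^+ i); split.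
      apply: laurentM; last first.
        apply: laurent_sum => i; apply: laurentM; apply: laurentX => //.
        by apply: laurentD => //; apply: laurentM.
      by apply: laurentM; [apply: laurentX | apply: laurent_exp; lint].
    move=> g; rewrite mul0r add0r /q /t -{1}(prednK c_gt0) exprS; ring.
  have tE g : t g = expR (A g) by rewrite /t c0 mul1r.
  have /choice [r rE] : forall i : 'I_b.+1, exists r, laurent r /\
      forall g, (y g + z g * t g) ^+ (b - i) = y g ^+ (b - i) + z g * r g.
    by move=> i; apply: expand.
  exists b.+1, (fun g => t g * \sum_(i < b.+1) r i g * y g ^+ i); split.
    apply: laurentM => //; apply: laurent_sum => i.
    by apply: laurentM; [case: (rE i) | apply: laurentX].
  move=> g; rewrite /q (eq_bigr (fun i : 'I_b.+1 => y g ^+ b + z g * (r i g * y g ^+ i))).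
    rewrite big_split /= sumr_const card_ord -mulr_sumr mulrDr; congr (_ + _); last by ring.
    by rewrite tE expRD expRM_natl /y -mulr_natl; ring.
  move=> i _; rewrite (rE i).2 mulrDl -exprD subnK ?mulrA //.
  by rewrite -ltnS.
have v_eq2 g : v g = expR (l g) * (1 + k%:R * expR (A g + b%:R * P g + m g - l g))
    + z g * (r g * expR (m g)).
  have e : expR (A g + b%:R * P g) * expR (m g) =
      expR (l g) * expR (A g + b%:R * P g + m g - l g).
    by rewrite -!expRD; congr expR; ring.
  by rewrite v_eq kE mulrDl -(mulrA k%:R) e; ring.
split.
  rewrite (funext v_eq); apply: laurentD; first exact: laurent_exp.
  by apply: laurentM => //; apply: laurent_exp.
rewrite (funext v_eq2); apply: nzd_modD.
  by apply: laurentM => //; apply: laurent_exp.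
apply: nzd_modM; [exact: laurent_exp | exact: nzd_mod_exp |].
(* Since [l] contains [gi] with coefficient $1$, the quotient of the two monomials has degree $-1$
   along the flow, and so has [z]. *)
apply: (@nzd_mod_1Dhom R J phi (-1) z (-1)) => //.
- move=> g s; rewrite !zE giE gj_inv.2 M_inv.2 N_inv.2 opprD [expR (- gi g - s)]expRD rmorphN mulrN1; ring.
- move=> g s; rewrite A_inv.2 P_inv.2 /m /l giE M'_inv.2 N'_inv.2 gj_inv.2 M_inv.2.
  rewrite [RHS]mulrCA -expRD; congr (_ * expR _); rewrite rmorphN mulrN1; ring.
- apply: laurentM; first exact: (laurent_int _ _ k).
  by apply: laurent_exp; apply: int_linearD; [apply: int_linearD => //; lint | lint].
Qed.

End RankTwo.

(** * Seeds and exchanges *)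

Definition pos_part (x : int) : int := Num.max x 0.

Lemma pos_part_id x : 0 <= x -> pos_part x = x.
Proof. by rewrite /pos_part; lia. Qed.

Lemma pos_part_eq0 x : x <= 0 -> pos_part x = 0.
Proof. by rewrite /pos_part; lia. Qed.

Lemma pos_part_nat (n : nat) : pos_part n%:Z = n%:Z.
Proof. exact: pos_part_id. Qed.

Lemma pos_partN_nat (n : nat) : pos_part (- n%:Z) = 0.
Proof. by rewrite pos_part_eq0 // oppr_le0. Qed.

Lemma pos_partB x : pos_part x - pos_part (- x) = x.
Proof. by rewrite /pos_part; lia. Qed.

Lemma pos_partM x y : 0 <= y -> pos_part (x * y) = pos_part x * y.
Proof.
move=> y0; rewrite /pos_part; case: (lerP x 0) => x0.
  by rewrite mul0r max_r // mulr_le0_ge0.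
by rewrite max_l // mulr_ge0 // ltW.
Qed.

Section Mutation.
Variables I F : finType.
Implicit Types B : I + F -> I -> int.

Definition mutate B (k : I) : I + F -> I -> int := fun l j =>
  if (l == inl k) || (j == k) then - B l j
  else B l j + pos_part (B l k) * pos_part (B (inl k) j)
       - pos_part (- B l k) * pos_part (- B (inl k) j).

Lemma mutateN B k : mutate (fun l j => - B l j) k = (fun l j => - mutate B k l j).
Proof.
apply/funext => l; apply/funext => j; rewrite /mutate !opprK.
by case: ifP => // _; ring.
Qed.

Lemma mutateK B k : mutate (mutate B k) k = B.
Proof.
apply/funext => l; apply/funext => j; rewrite /mutate !eqxx orbT /=.
by case: (_ || _); rewrite ?opprK //; ring.
Qed.

(* The rows [inl i] form the exchange matrix, the rows [inr f] belong to      *)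
(* frozen variables. Mutation preserves the independence of the columns,      *)
(* which makes distinct exchange polynomials coprime.                         *)
Definition seed B :=
  (exists d : I -> int, (forall i, 0 < d i) /\
     forall i j, B (inl i) j * d j = - (B (inl j) i * d i)) /\
  (forall s : I -> int, (forall l, \sum_j B l j * s j = 0) -> forall j, s j = 0).

Lemma seed_diag B i : seed B -> B (inl i) i = 0.
Proof.
move=> [[d [d0 /(_ i i) e]] _]; have /eqP : B (inl i) i * d i = 0 by lia.
by rewrite mulf_eq0 (gt_eqF (d0 i)) orbF => /eqP.
Qed.

Lemma seed_mutate B k : seed B -> seed (mutate B k).
Proof.
move=> sB; have Bkk := seed_diag k sB; case: (sB) => [[d [d0 Bd]] Bind]; split.
  exists d; split=> // i j; rewrite /mutate !(inj_eq (@inl_inj I F)) orbC.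
  case: ifP => _; first by rewrite mulNr Bd mulNr.
  have e1 x y : pos_part (B (inl x) y) * d y = pos_part (- B (inl y) x) * d x.
    by rewrite -!pos_partM ?(ltW (d0 _)) // Bd mulNr.
  have e2 x y : pos_part (- B (inl x) y) * d y = pos_part (B (inl y) x) * d x.
    exact/esym/e1.
  rewrite mulrBl mulrDl -!mulrA (e1 k) (e2 k).
  rewrite (mulrCA _ _ (d k)) (mulrCA (pos_part (- B (inl i) k)) _ (d k)).
  by rewrite (e1 i) (e2 i) Bd; ring.
move=> s Hs.
(* Mutation adds to column $j$ the multiple $[-B_{kj}]_+$ of column $k$, negates column $k$, and
   adds multiples of row $k$ to the other rows. The column operation carries [s] to [s']; the row
   operation contributes nothing by [rowk]. *)
pose s' j := if j == k then \sum_(j | j != k) pos_part (- B (inl k) j) * s j - s k else s j.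
have rowk : \sum_(j | j != k) B (inl k) j * s j = 0.
  have e j : mutate B k (inl k) j = - B (inl k) j by rewrite /mutate eqxx.
  have := Hs (inl k); under eq_bigr do rewrite e mulNr.
  by rewrite sumrN (bigD1 k) //= Bkk mul0r add0r => /eqP; rewrite oppr_eq0 => /eqP.
have s'0 : forall j, s' j = 0.
  apply: Bind => l; rewrite (bigD1 k) //=.
  rewrite (eq_bigr (fun j => B l j * s j)) => [|j jk]; last by rewrite /s' ifN.
  rewrite /s' eqxx.
  have [->|lk] := eqVneq l (inl k); first by rewrite Bkk mul0r add0r.
  have := Hs l; rewrite (bigD1 k) //= [mutate _ _ _ k]/mutate eqxx orbT.
  rewrite (eq_bigr (fun j => B l j * s j + pos_part (B l k) * (B (inl k) j * s j)
    + B l k * (pos_part (- B (inl k) j) * s j))); last first.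
    move=> j /negPf jk; rewrite /mutate (negPf lk) jk /=.
    have := pos_partB (B l k); have := pos_partB (B (inl k) j).
    set a := pos_part (B (inl k) j); set a' := pos_part (- B (inl k) j).
    by set b := pos_part (B l k); set b' := pos_part (- B l k) => <- <-; ring.
  rewrite !big_split /= -!mulr_sumr rowk mulr0 addr0 => e.
  by rewrite -[RHS]e; ring.
have sE j : j != k -> s j = 0 by move=> /negPf jk; have := s'0 j; rewrite /s' jk.
move=> j; have [->|/sE//] := eqVneq j k.
have := s'0 k; rewrite /s' eqxx big1 ?sub0r => [/eqP|i /sE ->]; last by rewrite mulr0.
by rewrite oppr_eq0 => /eqP.
Qed.

End Mutation.

Section Exchange.
Variables (R : realType) (I F : finType).
Implicit Types (B : I + F -> I -> int) (g : I + F -> R).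

Definition inflow B k g : R := \sum_l (pos_part (B l k))%:~R * g l.

Definition outflow B k g : R := \sum_l (pos_part (- B l k))%:~R * g l.

(* The coordinates of a point are the logarithms of the cluster variables.    *)
Definition exchange B k g : I + F -> R := fun l =>
  if l == inl k then log_sum_exp (inflow B k g) (outflow B k g) - g l else g l.

Fixpoint exchanges B (w : seq I) g : I + F -> R :=
  if w is k :: w' then exchanges (mutate B k) w' (exchange B k g) else g.

Lemma int_linear_inflow B k : int_linear (inflow B k).
Proof. by exists (fun l => pos_part (B l k)). Qed.

Lemma int_linear_outflow B k : int_linear (outflow B k).
Proof. by exists (fun l => pos_part (- B l k)). Qed.

Lemma inflowN B k : inflow (fun l j => - B l j) k = outflow B k.
Proof. by []. Qed.

Lemma outflowN B k : outflow (fun l j => - B l j) k = inflow B k.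
Proof. by apply/funext => g; apply: eq_bigr => l _; rewrite opprK. Qed.

Lemma exchangeN B k : exchange (fun l j => - B l j) k = exchange B k.
Proof.
apply/funext => g; apply/funext => l; rewrite /exchange inflowN outflowN.
by rewrite log_sum_expC.
Qed.

Lemma flowB B k g : inflow B k g - outflow B k g = \sum_l (B l k)%:~R * g l.
Proof.
rewrite /inflow /outflow -sumrB; apply: eq_bigr => l _.
by rewrite -mulrBl -rmorphB pos_partB.
Qed.

Lemma eq_inflow B k g g' : (forall l, B l k != 0 -> g l = g' l) ->
  inflow B k g = inflow B k g'.
Proof.
move=> e; apply: eq_bigr => l _; have [->|/e -> //] := eqVneq (B l k) 0.
by rewrite (pos_part_nat 0) !mul0r.
Qed.

Lemma eq_outflow B k g g' : (forall l, B l k != 0 -> g l = g' l) ->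
  outflow B k g = outflow B k g'.
Proof. by move=> e; rewrite -!inflowN; apply: eq_inflow => l; rewrite oppr_eq0 => /e. Qed.

Lemma eq_exchange B B' k : (forall l, B l k = B' l k) -> exchange B k = exchange B' k.
Proof.
move=> e; apply/funext => g; apply/funext => l; rewrite /exchange.
by case: ifP => // _; congr (log_sum_exp _ _ - _); apply: eq_bigr => j _; rewrite e.
Qed.

Lemma exchange_neq B k g l : l != inl k -> exchange B k g l = g l.
Proof. by rewrite /exchange => /negPf ->. Qed.

Lemma expR_exchange B k g : expR (exchange B k g (inl k)) =
  (expR (inflow B k g) + expR (outflow B k g)) * expR (- g (inl k)).
Proof. by rewrite /exchange eqxx expRD expR_log_sum_exp. Qed.

Lemma exchange_mutate B k : exchange (mutate B k) k = exchange B k.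
Proof.
by rewrite -(exchangeN B); apply: eq_exchange => l; rewrite /mutate eqxx orbT.
Qed.

Lemma exchangeK B k : B (inl k) k = 0 -> involutive (exchange B k).
Proof.
move=> Bkk g; apply/funext => l; rewrite {1}/exchange; case: eqP => [->|/eqP lk].
  have e l' : B l' k != 0 -> exchange B k g l' = g l'.
    by move=> Bl'; apply: exchange_neq; apply: contraNneq Bl' => ->; rewrite Bkk.
  by rewrite (eq_inflow e) (eq_outflow e) /exchange eqxx subKr.
exact: exchange_neq.
Qed.

Lemma laurent_exchange B k l : laurent (fun g => expR (exchange B k g l)).
Proof.
rewrite /exchange; have [_|_] := eqVneq l (inl k); last first.
  exact/laurent_exp/int_linear_coord.
apply: (@laurent_ext _ _ (fun g => (expR (inflow B k g) + expR (outflow B k g)) * expR (- g l))).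
  by move=> g; rewrite expRD expR_log_sum_exp.
apply: laurentM; last exact/laurent_exp/int_linearN/int_linear_coord.
by apply: laurentD; apply: laurent_exp; [apply: int_linear_inflow | apply: int_linear_outflow].
Qed.

Definition exchange3 B i j g :=
  exchange (mutate (mutate B i) j) i (exchange (mutate B i) j (exchange B i g)).

(** Here [z] is the variable created by the first exchange. The variables present after all three
    exchanges must be usable as denominators coprime to it. *)
Definition coprime_exchanges B i j :=
  let z g := expR (exchange B i g (inl i)) in
  forall k, k = i \/ k = j ->
  laurent (fun g => expR (exchange3 B i j g (inl k)))
    /\ nzd_mod z (fun g => expR (exchange3 B i j g (inl k))).

Lemma coprime_exchangesN B i j :
  coprime_exchanges (fun l k => - B l k) i j -> coprime_exchanges B i j.
Proof.
rewrite /coprime_exchanges /exchange3 exchangeN mutateN exchangeN.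
by rewrite mutateN exchangeN.
Qed.

End Exchange.

(** * The Laurent phenomenon *)

Section LaurentPhenomenon.
Variables (R : realType) (I F : finType).
Implicit Types (B : I + F -> I -> int) (g : I + F -> R).

(** With the row of [j] split off, what remains is one of the forms [M], [N], [A], [P] of the
    rank-two computation. *)
Let cropped B k (j : I) g : R := \sum_(l | l != inl j) (B l k)%:~R * g l.

Lemma int_linear_cropped B k j : int_linear (cropped B k j).
Proof.
apply: int_linear_sum => l.
exact/(@int_linearZ R (I + F)%type)/int_linear_coord.
Qed.

Definition coord_flow (i : I) : I + F -> int := fun l => (l == inl i)%:Z.

Lemma cropped_invariant B k j i g s : B (inl i) k = 0 ->
  cropped B k j (shift (coord_flow i) s g) = cropped B k j g.
Proof.
move=> Bik; apply: eq_bigr => l _; rewrite /shift /coord_flow.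
by have [->|_] := eqVneq l (inl i); rewrite ?Bik ?mul0r // mulr0 addr0.
Qed.

Lemma cropped_eq B k j (i : I) g g' : B (inl i) k = 0 ->
  (forall l, l != inl i -> l != inl j -> g l = g' l) -> cropped B k j g = cropped B k j g'.
Proof.
move=> Bik e; apply: eq_bigr => l lj.
by have [->|li] := eqVneq l (inl i); rewrite ?Bik ?mul0r // e.
Qed.

(** This is the rank-two computation, with the flow that moves only the coordinate of [i]. *)
Lemma coprime_exchanges_pos B i j b c : i != j ->
  B (inl i) i = 0 -> B (inl j) j = 0 ->
  B (inl j) i = b.+1%:Z -> B (inl i) j = - c.+1%:Z -> coprime_exchanges R B i j.
Proof.
move=> ij Bii Bjj Bji Bij.
have ji : inl j != inl i :> I + F by rewrite (inj_eq (@inl_inj _ _)) eq_sym.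
have ij' : inl i != inl j :> I + F by rewrite eq_sym.
pose B1 := mutate B i; pose B2 := mutate B1 j.
have B1i l : B1 l i = - B l i by rewrite /B1 /mutate eqxx orbT.
have B1ij : B1 (inl i) j = c.+1%:Z by rewrite /B1 /mutate eqxx Bij opprK.
have B1jj : B1 (inl j) j = 0.
  rewrite /B1 /mutate (negPf ji) eq_sym (negPf ij) /= Bjj Bji Bij opprK.
  by rewrite !pos_partN_nat mulr0 mul0r.
have B2ji : B2 (inl j) i = b.+1%:Z by rewrite /B2 /mutate eqxx B1i Bji opprK.
have B2i l : l != inl j -> B2 l i = - B l i - b.+1%:Z * pos_part (- B1 l j).
  move=> lj; rewrite /B2 /mutate (negPf lj) (negPf ij) /= !B1i Bji opprK.
  by rewrite pos_partN_nat pos_part_nat mulr0 addr0 mulrC.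
have B2ii : B2 (inl i) i = 0.
  by rewrite B2i // Bii B1ij pos_partN_nat mulr0.
pose posB (X : I + F -> I -> int) := fun l k => pos_part (X l k).
pose negB (X : I + F -> I -> int) := fun l k => pos_part (- X l k).
pose M := cropped (posB B) i j; pose N := cropped (negB B) i j.
pose M' := cropped (posB B2) i j; pose N' := cropped (negB B2) i j.
pose A := cropped (posB B1) j i; pose P := cropped (negB B1) j j.
have inv X k l : X (inl i) k = 0 -> int_linear (cropped X k l) /\
    forall g s, cropped X k l (shift (coord_flow i) s g) = cropped X k l g.
  by split; [apply: int_linear_cropped | move=> g s; apply: cropped_invariant].
pose z g := expR (exchange B i g (inl i)).
pose g1 g := exchange B i g.
pose u g := expR (exchange B1 j (g1 g) (inl j)).
pose g2 g := exchange B1 j (g1 g).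
pose v g := expR (exchange B2 i (g2 g) (inl i)).
have flow X k l g : inflow X k g =
    (pos_part (X (inl l) k))%:~R * g (inl l) + cropped (posB X) k l g.
  by rewrite /inflow (bigD1 (inl l)).
have flow' X k l g : outflow X k g =
    (pos_part (- X (inl l) k))%:~R * g (inl l) + cropped (negB X) k l g.
  by rewrite /outflow (bigD1 (inl l)).
have g1E g l : l != inl i -> g1 g l = g l by exact: exchange_neq.
have g2E g l : l != inl i -> l != inl j -> g2 g l = g l.
  by move=> li lj; rewrite /g2 exchange_neq // g1E.
have zE g : z g = (expR (b.+1%:R * g (inl j) + M g) + expR (N g)) * expR (- g (inl i)).
  rewrite /z expR_exchange (flow B i j) (flow' B i j) Bji pos_part_nat.
  by rewrite pos_partN_nat mul0r add0r.
have uE g : u g = (z g ^+ c.+1 * expR (A g) + expR (P g)) * expR (- g (inl j)).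
  rewrite /u expR_exchange (flow B1 j i) (flow' B1 j j) B1jj B1ij pos_part_nat.
  rewrite oppr0 (pos_part_nat 0) mul0r add0r (g1E g (inl j)) // expRD.
  congr ((_ * expR _ + expR _) * _); first by rewrite /z -expRM_natl.
    by apply: eq_bigr => l li; rewrite g1E.
  apply: (@cropped_eq _ _ _ i) => [|l li _]; last exact: g1E.
  by rewrite /negB B1ij pos_partN_nat.
have vE g : v g * z g = u g ^+ b.+1 * expR (M' g) + expR (N' g).
  rewrite /v expR_exchange (flow B2 i j) (flow' B2 i j) B2ji pos_part_nat.
  rewrite pos_partN_nat mul0r add0r.
  have -> : g2 g (inl i) = exchange B i g (inl i) by rewrite /g2 exchange_neq.
  rewrite -mulrA /z -expRD addNr expR0 mulr1 expRD.
  congr (_ * expR _ + expR _); first by rewrite /u -expRM_natl.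
    by apply: (@cropped_eq _ _ _ i) => [|l li lj]; [rewrite /posB B2ii | apply: g2E].
  by apply: (@cropped_eq _ _ _ i) => [|l li lj]; [rewrite /negB B2ii | apply: g2E].
have M'E g : M' g = N' g - M g + N g - b.+1%:R * P g.
  have cB X k l : cropped X k l g = cropped (posB X) k l g - cropped (negB X) k l g.
    rewrite /cropped -sumrB; apply: eq_bigr => x _.
    by rewrite -mulrBl -rmorphB pos_partB.
  (* The mutation rule for column [i]; splitting both sides into positive and negative parts gives
     [M'E]. *)
  have e : cropped B2 i j g = - cropped B i j g - b.+1%:R * P g.
    rewrite /P /cropped mulr_sumr -sumrN -sumrB; apply: eq_bigr => l lj.
    by rewrite B2i // rmorphB rmorphN rmorphM mulrBl mulNr mulrA.
  by rewrite -[LHS](subrK (N' g)) -cB e cB -/(M g) -/(N g); ring.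
have glin : int_linear (fun g => g (inl i) : R) by exact: int_linear_coord.
have giE (g : I + F -> R) s : shift (coord_flow i) s g (inl i) = g (inl i) + s.
  by rewrite /shift /coord_flow eqxx mulr1.
have gj_inv : int_linear (fun g => g (inl j) : R) /\
    forall g s, shift (coord_flow i) s g (inl j) = g (inl j).
  split=> [|g s]; first exact: int_linear_coord.
  by rewrite /shift /coord_flow (negPf ji) mulr0 addr0.
have M_inv := inv (posB B) i j (congr1 pos_part Bii).
have N_inv := inv (negB B) i j (congr1 (fun x => pos_part (- x)) Bii).
have M'_inv := inv (posB B2) i j (congr1 pos_part B2ii).
have N'_inv := inv (negB B2) i j (congr1 (fun x => pos_part (- x)) B2ii).
have A_inv : int_linear A /\ forall g s, A (shift (coord_flow i) s g) = A g.
  split=> [|g s]; first exact: int_linear_cropped.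
  apply: eq_bigr => l li; rewrite /shift /coord_flow (negPf li).
  by rewrite mulr0 addr0.
have P_inv : int_linear P /\ forall g s, P (shift (coord_flow i) s g) = P g.
  by apply: inv; rewrite /negB B1ij pos_partN_nat.
move=> k kij.
have uu := rank_two_u glin gj_inv M_inv N_inv A_inv P_inv zE uE.
have vv := rank_two_v glin giE gj_inv M_inv N_inv A_inv P_inv M'_inv N'_inv M'E zE uE vE.
case: kij => ->; first exact: vv.
rewrite (_ : (fun g => _) = u) // funeqE => g.
by rewrite /exchange3 exchange_neq.
Qed.

(** Without an arrow between [i] and [j] the exchanges commute. The third one restores the old
    variable of [i], a unit, and it remains to see that the exchange polynomials of [i] and [j] are
    coprime. *)
Lemma coprime_exchanges0 B i j : seed B -> i != j ->
  B (inl j) i = 0 -> B (inl i) j = 0 -> coprime_exchanges R B i j.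
Proof.
move=> sB ij Bji Bij; have Bii := seed_diag i sB; have Bjj := seed_diag j sB.
have E1 : exchange (mutate B i) j = exchange B j :> (_ -> _ -> R).
  apply: eq_exchange => l; rewrite /mutate (eq_sym j) (negPf ij) orbF.
  have [->|_] := eqVneq l (inl i); first by rewrite Bij.
  by rewrite Bij oppr0 (pos_part_nat 0) !mulr0 addr0 subr0.
have E2 : exchange (mutate (mutate B i) j) i = exchange B i :> (_ -> _ -> R).
  rewrite -(exchangeN _ B); apply: eq_exchange => l.
  have e x : mutate B i x i = - B x i by rewrite /mutate eqxx orbT.
  rewrite {1}/mutate (negPf ij) orbF !e.
  have [->|_] := eqVneq l (inl j); first by rewrite Bji oppr0.
  by rewrite Bji !oppr0 (pos_part_nat 0) !mulr0 addr0 subr0.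
have ji : inl j != inl i :> I + F by rewrite (inj_eq (@inl_inj _ _)) eq_sym.
have ij' : inl i != inl j :> I + F by rewrite eq_sym.
have vE g : exchange3 B i j g (inl i) = g (inl i) :> R.
  rewrite /exchange3 E1 E2 {1}/exchange eqxx exchange_neq //.
  have e l : B l i != 0 -> exchange B j (exchange B i g) l = g l.
    have [->|lj] := eqVneq l (inl j); first by rewrite Bji.
    have [->|li] := eqVneq l (inl i); first by rewrite Bii.
    by rewrite !exchange_neq.
  by rewrite (eq_inflow e) (eq_outflow e) /exchange eqxx subKr.
have uE g : expR (exchange3 B i j g (inl j)) = expR (outflow B j g - g (inl j)) *
    (1 + expR (inflow B j g - outflow B j g)) :> R.
  rewrite /exchange3 E1 E2 exchange_neq // expR_exchange exchange_neq //.
  have e l : B l j != 0 -> exchange B i g l = g l.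
    by move=> Bl; apply: exchange_neq; apply: contraNneq Bl => ->; rewrite Bij.
  rewrite (eq_inflow e) (eq_outflow e) mulrDl -!expRD mulrDr mulr1 -expRD addrC.
  by congr (_ + expR _); ring.
pose z g : R := expR (exchange B i g (inl i)).
have Lz : laurent z by apply: laurent_exchange.
move=> k kij; have {kij} [->|->] : k = i \/ k = j by [].
  under eq_fun do rewrite vE.
  split; first exact/laurent_exp/int_linear_coord.
  exact/nzd_mod_exp/int_linear_coord.
(* Gram-Schmidt: [phi] is a multiple of the part of column [j] orthogonal to column [i]. In this
   grading [z] is homogeneous, while the two monomials of the exchange of [j] have degrees differing
   by [dj]. *)
pose ii : int := \sum_l B l i * B l i; pose ij0 : int := \sum_l B l i * B l j.
pose phi l := ii * B l j - ij0 * B l i.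
have phii : \sum_l B l i * phi l = 0.
  rewrite (eq_bigr (fun l => ii * (B l i * B l j) - ij0 * (B l i * B l i))).
    by rewrite sumrB -!mulr_sumr mulrC subrr.
  by move=> l _; rewrite /phi; ring.
pose dj := \sum_l B l j * phi l.
have dj_neq0 : dj != 0.
  apply/eqP => dj0.
  have /eqP : \sum_l phi l * phi l = 0.
    rewrite (eq_bigr (fun l => ii * (B l j * phi l) - ij0 * (B l i * phi l))).
      by rewrite sumrB -!mulr_sumr -/dj dj0 phii !mulr0 subr0.
    by move=> l _; rewrite {1}/phi; ring.
  rewrite psumr_eq0 => [/allP phi0|l _]; last by rewrite -expr2 sqr_ge0.
  have {}phi0 l : phi l = 0.
    by have := phi0 l (mem_index_enum l); rewrite mulf_eq0 orbb => /eqP.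
  have [_ ind] := sB.
  (* If [phi] vanished, it would be a relation between the columns [i] and [j]; independence forces
     [ii] to be zero, hence column [i] to be zero, which is again impossible. *)
  have ii0 : ii = 0.
    have := ind (fun x => ii * (x == j)%:Z - ij0 * (x == i)%:Z) _ j.
    rewrite eqxx eq_sym (negPf ij) mulr1 mulr0 subr0; apply=> l.
    rewrite (bigD1 i) //= (bigD1 j) 1?eq_sym //= big1 => [|x /andP[/negPf xi /negPf xj]].
      rewrite !eqxx (eq_sym j) (negPf ij) !(mulr1, mulr0) -[RHS](phi0 l) /phi.
      by ring.
    by rewrite xi xj !mulr0.
  have B0 l : B l i = 0.
    have /eqP := ii0; rewrite psumr_eq0 => [/allP/(_ l)|x _]; last by rewrite -expr2 sqr_ge0.
    by rewrite mem_index_enum mulf_eq0 orbb => /(_ isT)/eqP.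
  suff : (i == i)%:Z = 0 by rewrite eqxx.
  apply: (ind (fun x => (x == i)%:Z)) => l.
  rewrite (bigD1 i) //= B0 mul0r add0r big1 // => x /negPf ->.
  by rewrite mulr0.
have hz : exists d, homogeneous phi d z.
  exists ((\sum_l pos_part (B l i) * phi l) - phi (inl i)) => g s.
  have e : \sum_l pos_part (B l i) * phi l = \sum_l pos_part (- B l i) * phi l.
    apply/eqP; rewrite -subr_eq0 -sumrB -[eqbRHS]phii; apply/eqP/eq_bigr => l _.
    by rewrite -mulrBl pos_partB.
  rewrite /z !expR_exchange /inflow /outflow.
  rewrite -!/(pairing (fun l => pos_part (B l i)) _) -!/(pairing (fun l => pos_part (- B l i)) _).
  rewrite !pairing_shift -e /shift [in RHS]rmorphB mulrBr opprD !expRD; ring.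
have hw : homogeneous phi dj (fun g => expR (inflow B j g - outflow B j g)).
  move=> g s; rewrite !flowB -!/(pairing (fun l => B l j) _).
  by rewrite pairing_shift expRD.
have Lw : laurent (fun g : _ -> R => expR (inflow B j g - outflow B j g)).
  apply: laurent_exp; apply: int_linearD; first exact: int_linear_inflow.
  exact/int_linearN/int_linear_outflow.
have Ll : int_linear (fun g : _ -> R => outflow B j g - g (inl j)).
  apply: int_linearD; first exact: int_linear_outflow.
  exact/int_linearN/int_linear_coord.
rewrite (funext uE); split.
  apply: laurentM; first exact: laurent_exp.
  by apply: laurentD => //; apply: (laurent_int _ _ 1).
case: hz => dz hz.
apply: nzd_modM; [exact: laurent_exp | exact: nzd_mod_exp |].
exact: (nzd_mod_1Dhom hz Lz hw Lw).
Qed.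

(** Skew-symmetrizability makes the entries at $(j,i)$ and $(i,j)$ vanish together or have opposite
    signs; changing the sign of [B] covers the remaining orientation. *)
Lemma coprime_exchanges_seed B i j : seed B -> i != j -> coprime_exchanges R B i j.
Proof.
move=> sB ij; have [[d [d0 Bd]] _] := sB.
have Bij := Bd i j; have di := d0 i; have dj := d0 j.
have Bii := seed_diag i sB; have Bjj := seed_diag j sB.
case: (ltrgtP (B (inl j) i) 0) => [neg|pos|e].
- apply: coprime_exchangesN.
  apply: (@coprime_exchanges_pos _ i j (absz (B (inl j) i)).-1 (absz (B (inl i) j)).-1) => //.
  + by rewrite Bii oppr0.
  + by rewrite Bjj oppr0.
  + by lia.
  + by have : 0 < B (inl i) j; [rewrite -(pmulr_lgt0 _ dj) Bij oppr_gt0 pmulr_llt0 | lia].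
- apply: (@coprime_exchanges_pos _ i j (absz (B (inl j) i)).-1 (absz (B (inl i) j)).-1) => //.
  + by lia.
  + by have : B (inl i) j < 0; [rewrite -(pmulr_llt0 _ dj) Bij oppr_lt0 pmulr_lgt0 | lia].
- apply: coprime_exchanges0 => //.
  by move: Bij; rewrite e mul0r oppr0 => /eqP; rewrite mulf_eq0 (gt_eqF dj) orbF => /eqP.
Qed.

Lemma exchange3_neq B i j g l :
  l != inl i -> l != inl j -> exchange3 B i j g l = g l.
Proof. by move=> li lj; rewrite /exchange3 !exchange_neq. Qed.

(* A word [i j w] from [B] factors as the word [j w] from [mutate B i] and as *)
(* the word [i w] from the seed reached by [i j i]; the two denominators are  *)
(* coprime.                                                                   *)
Theorem laurent_exchanges B (w : seq I) (l : I + F) :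
  seed B -> laurent (fun g => expR (exchanges B w g l)).
Proof.
have [n] := ubnP (size w); elim: n => // n IH in w B l *.
case: w => [|i [|j w]] /=; rewrite ?ltnS => wn sB.
- exact/laurent_exp/int_linear_coord.
- exact: laurent_exchange.
have sB1 := seed_mutate i sB; have sB2 := seed_mutate j sB1.
have sB3 := seed_mutate i sB2.
(* Two successive exchanges at the same place cancel, which shortens the word by two. *)
have [<-|ij] := eqVneq i j.
  rewrite mutateK exchange_mutate.
  under eq_fun do rewrite exchangeK ?(seed_diag _ sB) //.
  by apply: IH => //; apply: leq_ltn_trans wn.
pose z g := expR (exchange B i g (inl i)).
pose u g := expR (exchange3 B i j g (inl j)).
pose v g := expR (exchange3 B i j g (inl i)).
have cop := coprime_exchanges_seed sB ij.
have [Lv nv] : laurent v /\ nzd_mod z v by apply: (cop i); left.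
have [Lu nu] : laurent u /\ nzd_mod z u by apply: (cop j); right.
have Lz : laurent z by apply: laurent_exchange.
have z0 g : z g != 0 by rewrite gt_eqF ?expR_gt0.
(* By induction the result is Laurent in the cluster after [i], whose only new variable is [z]. *)
have [a La] : exists a, laurent (fun g => z g ^+ a *
    expR (exchanges (mutate (mutate B i) j) w (exchange (mutate B i) j (exchange B i g)) l)).
  apply: (laurent_pullback (Th := exchange B i)
    (f := fun g => expR (exchanges (mutate (mutate B i) j) w (exchange (mutate B i) j g) l))) => //.
  - by move=> k; apply: laurent_exchange.
  - move=> k; have [->|kj] := eqVneq k (inl i).
      by under eq_fun do rewrite /z -expRD subrr; apply/laurent_exp/int_linear0.
    under eq_fun do rewrite (exchange_neq _ _ kj).
    by apply: laurentM => //; apply/laurent_exp/int_linearN/int_linear_coord.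
  - exact: (IH (j :: w)).
(* Undoing the third exchange of $i\,j\,i$ gives the same result from the cluster reached there,
   whose new variables are [u] and [v]. The word [i :: w] is short enough for the induction. *)
have [b Lb] : exists b, laurent (fun g => (u g * v g) ^+ b *
    expR (exchanges (mutate (mutate B i) j) w (exchange (mutate B i) j (exchange B i g)) l)).
  have E g : expR (exchanges (mutate (mutate B i) j) w
        (exchange (mutate B i) j (exchange B i g)) l) =
      expR (exchanges (mutate (mutate (mutate B i) j) i) (i :: w) (exchange3 B i j g) l).
    rewrite /= mutateK exchange_mutate.
    by rewrite /exchange3 exchangeK ?(seed_diag _ sB2).
  suff [b Lb] : exists b, laurent (fun g => (u g * v g) ^+ b *
      expR (exchanges (mutate (mutate (mutate B i) j) i) (i :: w) (exchange3 B i j g) l)).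
    by exists b; apply: laurent_ext Lb => g; rewrite E.
  apply: (laurent_pullback (Th := exchange3 B i j)
    (f := fun g => expR (exchanges _ (i :: w) g l))); last exact: IH.
  - exact: laurentM.
  - move=> k; have [->//|ki] := eqVneq k (inl i); have [->//|kj] := eqVneq k (inl j).
    by under eq_fun do rewrite exchange3_neq //; apply/laurent_exp/int_linear_coord.
  - move=> k; have [->|ki] := eqVneq k (inl i).
      by under eq_fun do rewrite /v -mulrA -expRD subrr expR0 mulr1.
    have [->|kj] := eqVneq k (inl j).
      by under eq_fun do rewrite mulrAC /u -expRD subrr expR0 mul1r.
    under eq_fun do rewrite exchange3_neq //.
    apply: laurentM; first exact: laurentM.
    exact/laurent_exp/int_linearN/int_linear_coord.
apply: (laurent_clear_denom z0 Lz _ _ La Lb).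
  by apply: laurentX; apply: laurentM.
by apply: nzd_modX; [apply: laurentM | apply: nzd_modM].
Qed.

End LaurentPhenomenon.

(** * Exchange relations along chains *)

(* The T-system with its variables in one sequence: event [k] replaces the    *)
(* variable [k] by [pi k], using the variable [e] with exponents [np e k] and *)
(* [nm e k]; [np'] and [nm'] stand for D^-1 N_+ D and D^-1 N_- D, and         *)
(* [symplectic] is the part of A_+ D A_-^dagger = A_- D A_+^dagger that is    *)
(* needed.                                                                    *)
Section ExchangeChains.
Variables (R : realType) (V : finType) (iota : V -> nat) (pi : nat -> nat).
Variables (np nm np' nm' : nat -> nat -> int) (D : nat -> int).
Hypotheses (iota_inj : injective iota) (pi_inj : injective pi).
Hypothesis iota_neq_pi : forall x k, iota x <> pi k.
Hypothesis iota_pi_cover : forall e, (exists x, e = iota x) \/ (exists k, e = pi k).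
Hypothesis pi_gt : forall k, (k < pi k)%N.
Hypotheses (D_gt0 : forall k, 0 < D k) (D_pi : forall k, D (pi k) = D k).
Hypotheses (np_ge0 : forall e k, 0 <= np e k) (nm_ge0 : forall e k, 0 <= nm e k).
Hypothesis np_nm : forall e k, np e k * nm e k = 0.
Hypothesis np'D : forall e k, np' e k * D e = np e k * D k.
Hypothesis nm'D : forall e k, nm' e k * D e = nm e k * D k.
Hypothesis np_supp : forall e k, np e k != 0 -> (k < e)%N /\ forall j, e = pi j -> (j < k)%N.
Hypothesis nm_supp : forall e k, nm e k != 0 -> (k < e)%N /\ forall j, e = pi j -> (j < k)%N.
Hypothesis symplectic : forall e e', (e < e')%N -> (forall j, e' = pi j -> (j < e)%N) ->
  np e' (pi e) - nm e' (pi e) + (np e' e - nm e' e) - (np' (pi e) e' - nm' (pi e) e') =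
  \sum_(e.+1 <= k < pi e) (np e' k * nm' (pi e) k - nm e' k * np' (pi e) k).

(** The cluster before step [n]: position [x] holds the event that is next due in its chain, and
    step [n] advances the one position holding [n]. *)
Fixpoint chain_rep (n : nat) (x : V) : nat :=
  if n is m.+1 then
    if chain_rep m x == m then pi m else chain_rep m x
  else iota x.

Lemma chain_rep_ge n x : (n <= chain_rep n x)%N.
Proof.
elim: n => //= n IH; case: eqP => [_|/eqP ne]; first exact: pi_gt.
by rewrite ltn_neqAle eq_sym ne.
Qed.

Lemma chain_rep_pi n x k : chain_rep n x = pi k -> (k < n)%N.
Proof.
elim: n => /= [/iota_neq_pi//|n IH]; case: eqP => [_ /pi_inj <- //|_ /IH].
by move=> /leq_trans; apply.
Qed.

Lemma chain_rep_inj n : injective (chain_rep n).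
Proof.
elim: n => //= n IH x y; case: eqP => [ex|_]; case: eqP => [ey|_].
- by move=> _; apply: IH; rewrite ex.
- by move=> /esym/chain_rep_pi; rewrite ltnn.
- by move=> /chain_rep_pi; rewrite ltnn.
- exact: IH.
Qed.

Lemma chain_rep_onto n e :
  (n <= e)%N -> (forall k, e = pi k -> (k < n)%N) -> exists x, chain_rep n x = e.
Proof.
elim: n e => [|n IH] e ne H.
  by case: (iota_pi_cover e) => [[x ->]|[k /H//]]; exists x.
have [epi|nepi] := eqVneq e (pi n).
  have [||x xn] := IH n; [by [] | by move=> k {1}->; apply: pi_gt |].
  by exists x; rewrite /= xn eqxx epi.
have [||x xe] := IH e; [exact: ltnW | | by exists x; rewrite /= xe gtn_eqF].
move=> k ek; have := H k ek; rewrite ltnS leq_eqVlt => /predU1P[kn|//].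
by rewrite ek kn eqxx in nepi.
Qed.

Lemma np'_eq0 e k : np e k = 0 -> np' e k = 0.
Proof.
move=> e0; have := np'D e k; rewrite e0 mul0r => /eqP.
by rewrite mulf_eq0 (gt_eqF (D_gt0 _)) orbF => /eqP.
Qed.

Lemma nm'_eq0 e k : nm e k = 0 -> nm' e k = 0.
Proof.
move=> e0; have := nm'D e k; rewrite e0 mul0r => /eqP.
by rewrite mulf_eq0 (gt_eqF (D_gt0 _)) orbF => /eqP.
Qed.

Lemma np_ge_eq0 e k : (e <= k)%N -> np e k = 0.
Proof. by move=> ek; apply/eqP/negPn/negP => /np_supp[]; rewrite ltnNge ek. Qed.

Lemma nm_ge_eq0 e k : (e <= k)%N -> nm e k = 0.
Proof. by move=> ek; apply/eqP/negPn/negP => /nm_supp[]; rewrite ltnNge ek. Qed.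

Let K e' e k := np e' k * nm' e k - nm e' k * np' e k.

(* The column of an event is [np - nm] when it is due, the row then follows by *)
(* skew-symmetry; the sum undoes the mutations between step [n] and that time. *)
Definition chain_matrix (n e' e : nat) : int :=
  np e' e - nm e' e - (np' e e' - nm' e e') - \sum_(n <= k < e) K e' e k.

Lemma K_eq0 e' e k : (e <= k)%N || (e' <= k)%N -> K e' e k = 0.
Proof.
case/orP => le; rewrite /K.
  by rewrite (nm'_eq0 (nm_ge_eq0 le)) (np'_eq0 (np_ge_eq0 le)) !mulr0 subrr.
by rewrite (nm_ge_eq0 le) (np_ge_eq0 le) !mul0r subrr.
Qed.

Lemma K_skew e' e k : K e' e k * D e = - (K e e' k * D e').
Proof. by rewrite /K !mulrBl -!mulrA np'D nm'D np'D nm'D; ring. Qed.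

Lemma sumK_widen n e' e m : (e <= m)%N ->
  \sum_(n <= k < e) K e' e k = \sum_(n <= k < m) K e' e k.
Proof.
move=> em; case: (leqP n e) => [ne|en].
  rewrite [RHS](big_cat_nat (n := e)) //= [X in _ + X]big_nat_cond [X in _ + X]big1 ?addr0 // => k.
  by rewrite andbT => /andP[ek _]; rewrite K_eq0 // ek.
rewrite big_geq ?(ltnW en) // big_nat_cond big1 // => k.
by rewrite andbT => /andP[nk _]; rewrite K_eq0 // (leq_trans (ltnW en) nk).
Qed.

Lemma chain_matrix_skew n e' e :
  chain_matrix n e' e * D e = - (chain_matrix n e e' * D e').
Proof.
rewrite /chain_matrix (@sumK_widen n e' e (maxn e e')) ?leq_maxl //.
rewrite (@sumK_widen n e e' (maxn e e')) ?leq_maxr //.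
set S := \sum_(n <= k < _) K e' e k; set S' := \sum_(n <= k < _) K e e' k.
have SS : S * D e = - (S' * D e').
  by rewrite !mulr_suml -sumrN; apply: eq_bigr => k _; apply: K_skew.
by rewrite !mulrBl !np'D !nm'D SS -!np'D -!nm'D; ring.
Qed.

Lemma chain_matrix_col n e' : (n <= e')%N -> chain_matrix n e' n = np e' n - nm e' n.
Proof.
move=> ne; rewrite /chain_matrix big_geq // subr0.
by rewrite (np'_eq0 (np_ge_eq0 ne)) (nm'_eq0 (nm_ge_eq0 ne)) subrr subr0.
Qed.

Lemma chain_matrix_row n e : (n <= e)%N -> chain_matrix n n e = - (np' e n - nm' e n).
Proof.
move=> ne; apply: (mulIf (lt0r_neq0 (D_gt0 e))); rewrite chain_matrix_skew.
by rewrite chain_matrix_col // mulNr !mulrBl np'D nm'D.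
Qed.

Lemma pos_part_disjoint (x y : int) : 0 <= x -> 0 <= y -> x * y = 0 ->
  pos_part (x - y) = x /\ pos_part (y - x) = y.
Proof.
move=> x0 y0 /eqP; rewrite mulf_eq0 => /orP[]/eqP ->.
  by rewrite sub0r subr0 (pos_part_eq0 (x := - _)) ?oppr_le0 // pos_part_id.
by rewrite sub0r subr0 (pos_part_eq0 (x := - _)) ?oppr_le0 // pos_part_id.
Qed.

(** Passing to step [n.+1] removes the summand [K e' e n]. As [np] and [nm] have disjoint supports,
    this is the correction term of a mutation. *)
Lemma chain_matrix_next n e' e : (n < e')%N -> (n < e)%N ->
  chain_matrix n.+1 e' e = chain_matrix n e' e
    + pos_part (chain_matrix n e' n) * pos_part (chain_matrix n n e)
    - pos_part (- chain_matrix n e' n) * pos_part (- chain_matrix n n e).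
Proof.
move=> ne' ne; rewrite chain_matrix_col ?(ltnW ne') // chain_matrix_row ?(ltnW ne) //.
have [-> e1] := pos_part_disjoint (np_ge0 e' n) (nm_ge0 e' n) (np_nm e' n).
rewrite !opprB e1.
have np'_ge0 : 0 <= np' e n by rewrite -(pmulr_lge0 _ (D_gt0 e)) np'D mulr_ge0 // ltW.
have nm'_ge0 : 0 <= nm' e n by rewrite -(pmulr_lge0 _ (D_gt0 e)) nm'D mulr_ge0 // ltW.
have np'_nm' : np' e n * nm' e n = 0.
  have /eqP := np_nm e n; rewrite mulf_eq0 => /orP[]/eqP e0.
    by rewrite np'_eq0 // mul0r.
  by rewrite nm'_eq0 // mulr0.
have [-> ->] := pos_part_disjoint np'_ge0 nm'_ge0 np'_nm'.
by rewrite /chain_matrix (big_ltn ne) /K; ring.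
Qed.

(** This is where [symplectic] enters: it says that the column of the new variable is the negative
    of the column of the variable it replaces. *)
Lemma chain_matrix_pi n e' : (n < e')%N -> (forall j, e' = pi j -> (j < n)%N) ->
  chain_matrix n.+1 e' (pi n) = - chain_matrix n e' n.
Proof.
move=> ne H; rewrite chain_matrix_col ?(ltnW ne) // /chain_matrix.
by rewrite -(symplectic ne H); ring.
Qed.

Lemma chain_matrix_pi_row n e : (n < e)%N -> (forall j, e = pi j -> (j < n)%N) ->
  chain_matrix n.+1 (pi n) e = - chain_matrix n n e.
Proof.
move=> ne H; apply: (mulIf (lt0r_neq0 (D_gt0 e))); rewrite chain_matrix_skew.
by rewrite chain_matrix_pi // D_pi !mulNr (chain_matrix_skew n n).
Qed.

Lemma chain_matrix_diag n e : chain_matrix n e e = 0.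
Proof.
have h := chain_matrix_skew n e e.
have /eqP : chain_matrix n e e * D e = 0 by lia.
by rewrite mulf_eq0 (gt_eqF (D_gt0 _)) orbF => /eqP.
Qed.

(* Principal coefficients guarantee independent columns.                      *)
Definition chain_seed : V + V -> V -> int := fun l x =>
  match l with
  | inl y => chain_matrix 0 (iota y) (iota x)
  | inr y => (y == x)%:Z
  end.

Lemma seed_chain_seed : seed chain_seed.
Proof.
split.
  by exists (fun x => D (iota x)); split=> // x y; apply: chain_matrix_skew.
move=> s H x; have := H (inr x); rewrite (bigD1 x) //= eqxx mul1r.
by rewrite big1 ?addr0 // => y; rewrite eq_sym => /negPf ->; rewrite mul0r.
Qed.

Lemma exchanges_rcons (I F : finType) (B : I + F -> I -> int) w k (g : I + F -> R) :
  exchanges B (rcons w k) g = exchange (foldl (@mutate I F) B w) k (exchanges B w g).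
Proof. by elim: w B g => //= j w IH B g; rewrite IH. Qed.

Variable L : nat -> R.
Hypothesis L_iota : forall x, L (iota x) = 0.
Hypothesis L_pi : forall n, L n + L (pi n) = log_sum_exp
  (\sum_x (np (chain_rep n x) n)%:~R * L (chain_rep n x))
  (\sum_x (nm (chain_rep n x) n)%:~R * L (chain_rep n x)).

Lemma chain_word n : exists w,
  (forall x, exchanges chain_seed w (fun=> 0 : R) (inl x) = L (chain_rep n x)) /\
  (forall y, exchanges chain_seed w (fun=> 0 : R) (inr y) = 0) /\
  forall x y, foldl (@mutate V V) chain_seed w (inl x) y =
    chain_matrix n (chain_rep n x) (chain_rep n y).
Proof.
elim: n => [|n [w [wl [wr wm]]]]; first by exists [::]; split=> // x; rewrite /= L_iota.
have [x0 x0n] : exists x, chain_rep n x = n.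
  by apply: chain_rep_onto => // k ->; apply: pi_gt.
have neq x : (chain_rep n x == n) = (x == x0).
  by rewrite -{2}x0n (inj_eq (@chain_rep_inj n)).
have gt x : x != x0 -> (n < chain_rep n x)%N.
  by rewrite -neq ltn_neqAle eq_sym chain_rep_ge => ->.
have pin x : x != x0 -> forall j, chain_rep n x = pi j -> (j < n)%N.
  by move=> _ j; apply: chain_rep_pi.
exists (rcons w x0); rewrite exchanges_rcons foldl_rcons; split; [|split].
- move=> x /=; rewrite neq /exchange (inj_eq (@inl_inj _ _)).
  case: eqP => [->|_]; last exact: wl.
  rewrite wl x0n; apply/eqP; rewrite subr_eq addrC L_pi; apply/eqP; congr log_sum_exp.
    rewrite /inflow big_sumType /= [X in _ + X]big1 ?addr0 => [|y _]; last by rewrite wr mulr0.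
    apply: eq_bigr => y _; rewrite wl wm x0n chain_matrix_col ?chain_rep_ge //.
    by rewrite (pos_part_disjoint (np_ge0 _ _) (nm_ge0 _ _) (np_nm _ _)).1.
  rewrite /outflow big_sumType /= [X in _ + X]big1 ?addr0 => [|y _]; last by rewrite wr mulr0.
  apply: eq_bigr => y _; rewrite wl wm x0n chain_matrix_col ?chain_rep_ge // opprB.
  by rewrite (pos_part_disjoint (np_ge0 _ _) (nm_ge0 _ _) (np_nm _ _)).2.
- by move=> y; rewrite exchange_neq.
- move=> x y /=; rewrite !neq /mutate !(inj_eq (@inl_inj _ _)) !wm x0n.
  have [->|xx0] := eqVneq x x0; have [->|yx0] := eqVneq y x0 => /=.
  + by rewrite x0n !chain_matrix_diag oppr0.
  + by rewrite x0n (chain_matrix_pi_row (gt _ yx0) (pin _ yx0)).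
  + by rewrite x0n (chain_matrix_pi (gt _ xx0) (pin _ xx0)).
  + by rewrite (chain_matrix_next (gt _ xx0) (gt _ yx0)).
Qed.

(** With all initial variables equal to $1$, an integral Laurent polynomial takes an integer value.
    This value is an exponential, hence at least $1$. *)
Theorem chain_log_ge0 e : 0 <= L e.
Proof.
have [w [wl _]] := chain_word e.
have [x xe] : exists x, chain_rep e x = e.
  by apply: chain_rep_onto => // k ->; apply: pi_gt.
have [m me] := laurent_at0 (laurent_exchanges R w (inl x) seed_chain_seed).
move: me; rewrite wl xe => me.
have m_gt0 : 0 < m by rewrite -(ltr0z R) -me expR_gt0.
by rewrite leNgt -expR_lt1 -leNgt me ler1z; lia.
Qed.

End ExchangeChains.

(** * Evaluating the T-algebra *)

Section MonomialEvaluation.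
Variables (R : realType) (I : choiceType) (x : I -> R).

Definition exp_monom (m : {cmonom I}) : R := expR (\sum_(i <- finsupp m) (m i)%:R * x i).

Lemma exp_monomEw (m : {cmonom I}) (d : {fset I}) : (finsupp m `<=` d)%fset ->
  exp_monom m = expR (\sum_(i <- d) (m i)%:R * x i).
Proof.
move=> le; rewrite /exp_monom (big_fset_incl _ le) // => i _.
by rewrite -cmE_neq0 negbK => /eqP ->; rewrite mul0r.
Qed.

Lemma exp_monom_mmorphism : mmorphism exp_monom.
Proof.
split=> [m m'|]; last by rewrite /exp_monom mdom1 big_seq_fset0 expR0.
rewrite {1}/exp_monom mdomD (exp_monomEw (fsubsetUl _ (finsupp m'))).
rewrite (exp_monomEw (fsubsetUr (finsupp m) _)) -expRD -big_split /=.
by congr expR; apply: eq_bigr => i _; rewrite cmM natrD mulrDl.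
Qed.

HB.instance Definition _ := isMultiplicative.Build {cmonom I} R exp_monom exp_monom_mmorphism.

Definition exp_eval : {malg int[{cmonom I}]} -> R := mmap (intr : int -> R) exp_monom.

HB.instance Definition _ := GRing.RMorphism.on exp_eval.

Lemma exp_evalU i : exp_eval << ucm i >> = expR (x i).
Proof.
rewrite /exp_eval mmapU mul1r /exp_monom mdomU big_seq_fset1 /=.
by rewrite -[ucm i i]/(ucm i i) cmUU mul1r.
Qed.

End MonomialEvaluation.

Lemma quot_pi_morph (A : comNzRingType) (G : A -> Prop) (S : nzRingType)
    (f : {rmorphism A -> S}) : (forall x, G x -> f x = 0) ->
  forall x y, quot_pi G x = quot_pi G y -> f x = f y.
Proof.
move=> fG x y /quot_pi_eq/asboolP/(_ [pred z | f z == 0]).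
rewrite inE rmorphB subr_eq0 => H; apply/eqP/H => [|z /fG fz].
  split; first split.
  - by rewrite inE rmorph0.
  - by move=> a b; rewrite !inE => /eqP fa /eqP fb; rewrite rmorphB fa fb subrr.
  - by move=> a b; rewrite !inE => /eqP fb; rewrite rmorphM fb mulr0.
by rewrite inE fz.
Qed.

(** As [f] kills the relators, [x a u] depends only on the element $T_a(u)$ of the algebra, so
    finitely many elements give finitely many values. *)
Lemma finite_type_bounded (R : realType) r (alpha : T_datum r) (x : 'I_r -> int -> R)
    (f : {rmorphism Tfree r -> R}) :
  finite_type alpha -> (forall a u, f (Tvar a u) = x a u) ->
  (forall y, is_Trelator (T_triple alpha) y -> f y = 0) ->
  exists C, forall a u, x a u <= C.
Proof.
move=> fin fx frel.
(* The value is defined by choosing an index pair; elements that are not generators get the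
   irrelevant value $0$. *)
pose h (y : T_subalgebra alpha) : R :=
  if pselect (exists au : 'I_r * int, y = Tcirc alpha au.1 au.2) is left e
  then x (projT1 (cid e)).1 (projT1 (cid e)).2 else 0.
have hE a u : h (Tcirc alpha a u) = x a u.
  rewrite /h; case: pselect => [e|]; last by case; exists (a, u).
  case: (cid e) => [[b w] /= /(congr1 (@subring_val _ _)) /= E].
  by rewrite -!fx; apply/esym/(quot_pi_morph frel).
have /finite_seqP[s sP] := finite_image h fin.
exists (\sum_(y <- s) `|y|) => a u.
have : x a u \in s.
  have : (h @` range (fun au : 'I_r * int => Tcirc alpha au.1 au.2))%classic (x a u).
    by exists (Tcirc alpha a u); [exists (a, u) | apply: hE].
  by rewrite sP.
move=> xs; rewrite (big_rem _ xs) /=; apply: le_trans (ler_norm _) _.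
by rewrite lerDl sumr_ge0.
Qed.

(** * Solutions of the T-system *)

(** Iterating [rule] from any function stabilizes at [x] after more than [m x] rounds. *)
Lemma measure_recursion (A B : Type) (m : A -> nat) (b : B)
    (rule : (A -> B) -> A -> B) :
  (forall f g x, (forall y, (m y < m x)%N -> f y = g y) -> rule f x = rule g x) ->
  exists f, forall x, f x = rule f x.
Proof.
move=> H; pose F n := iter n rule (fun=> b).
have stable n k x : (m x < n)%N -> F (n + k)%N x = F n x.
  elim: n x => // n IH x; rewrite ltnS => mx; apply: H => y my.
  by apply: IH; apply: leq_trans mx.
exists (fun x => F (m x).+1 x) => x; apply: H => y my.
by rewrite -(@stable (m y).+1 (m x - (m y).+1)%N) // subnKC.
Qed.

Lemma sum_ord_supp (V : nmodType) (n m : nat) (F : nat -> V) :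
  (forall k, (n <= k)%N -> F k = 0) -> (forall k, (m <= k)%N -> F k = 0) ->
  \sum_(k < n) F k = \sum_(k < m) F k.
Proof.
wlog nm : n m / (n <= m)%N => [H Hn Hm|Hn _].
  by case/orP: (leq_total n m) => le; [apply: H | apply/esym/H].
rewrite -(subnKC nm) big_split_ord /= [X in _ + X]big1 ?addr0 // => k _.
by rewrite Hn // leq_addr.
Qed.

Lemma sum_ord_delta (R : pzRingType) (n i : nat) (F : nat -> R) : (i < n)%N ->
  \sum_(k < n) (k == i :> nat)%:R * F k = F i.
Proof.
move=> lt_in; rewrite (bigD1 (Ordinal lt_in)) //= eqxx mul1r big1 ?addr0 // => k.
by rewrite -val_eqE /= => /negPf ->; rewrite mul0r.
Qed.

Lemma Tfree_exp_eval (R : realType) r (L : 'I_r -> int -> R) :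
  exists f : {rmorphism Tfree r -> R}, forall a u,
    f (Tvar a u) = expR (L a u) /\ f (Tvar_inv a u) = expR (- L a u).
Proof.
pose x (i : Tindex r) : R := if i.2 then - L i.1.1 i.1.2 else L i.1.1 i.1.2.
exists (exp_eval x) => a u; split.
  by transitivity (expR (x (a, u, false))); first rewrite -(exp_evalU x).
by transitivity (expR (x (a, u, true))); first rewrite -(exp_evalU x).
Qed.

Section TSystemSolution.
Variables (R : realType) (r : nat) (N : N_triple r) (sigma : 'S_r) (p_ : 'I_r -> nat).
Hypothesis p_gt0 : forall a, (0 < p_ a)%N.
Hypothesis N0E : forall a b k, (N0 N a b)`_k =
  (a == b)%:R * (k == 0%N)%:R + (a == sigma b)%:R * (k == p_ a)%:R.
Hypothesis N_ge0 : forall a b k, 0 <= (Nplus N a b)`_k /\ 0 <= (Nminus N a b)`_k.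
Hypothesis N_supp : forall a b k, ~~ (0 < k < p_ a)%N ->
  (Nplus N a b)`_k = 0 /\ (Nminus N a b)`_k = 0.
Implicit Types (L : 'I_r -> int -> R) (M : 'M[{poly int}]_r).

Definition log_monomial M a u L : R :=
  \sum_b \sum_(k < size (M b a)) (absz (M b a)`_k)%:R * L b (u + k%:Z).

Definition log_solution L := forall a u,
  L a u + L (sigma a) (u + (p_ (sigma a))%:Z) =
  log_sum_exp (log_monomial (Nplus N) a u L) (log_monomial (Nminus N) a u L).

Lemma log_monomialE M a u L (B : 'I_r -> nat) :
  (forall b k, 0 <= (M b a)`_k) -> (forall b k, (B b <= k)%N -> (M b a)`_k = 0) ->
  log_monomial M a u L = \sum_b \sum_(k < B b) ((M b a)`_k)%:~R * L b (u + k%:Z).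
Proof.
move=> M0 MB; apply: eq_bigr => b _.
under eq_bigr do rewrite -[(absz _)%:R]/((absz _)%:Z%:~R) gez0_abs //.
apply: (sum_ord_supp (F := fun k => ((M b a)`_k)%:~R * L b (u + k%:Z))) => k kb.
  by rewrite nth_default // mul0r.
by rewrite MB // mul0r.
Qed.

Lemma log_monomial_N0 a u L :
  log_monomial (N0 N) a u L = L a u + L (sigma a) (u + (p_ (sigma a))%:Z).
Proof.
rewrite (@log_monomialE _ _ _ _ (fun b => (p_ b).+1)); first last.
- move=> b k kb; rewrite N0E (gtn_eqF (leq_trans (ltn0Sn _) kb)) (gtn_eqF kb).
  by rewrite !mulr0 addr0.
- by move=> b k; rewrite N0E addr_ge0 // mulr_ge0 // ler0n.
rewrite (eq_bigr (fun b => (b == a)%:R * L b u + (b == sigma a)%:R * L b (u + (p_ b)%:Z))).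
  rewrite big_split /=; congr (_ + _).
    rewrite (bigD1 a) //= eqxx mul1r big1 ?addr0 // => b /negPf ->.
    by rewrite mul0r.
  rewrite (bigD1 (sigma a)) //= eqxx mul1r big1 ?addr0 // => b /negPf ->.
  by rewrite mul0r.
move=> b _; pose F k := L b (u + k%:Z).
have -> : L b u = F 0 by rewrite /F addr0.
rewrite -[L b _]/(F (p_ b)) -(sum_ord_delta F (ltn0Sn (p_ b))).
rewrite -(sum_ord_delta F (ltnSn (p_ b))).
rewrite !mulr_sumr -big_split; apply: eq_bigr => k _ /=.
by rewrite N0E rmorphD !rmorphM !rmorph_nat mulrDl !mulrA.
Qed.

Lemma log_monomial_local M a u L L' :
  (forall b k, (M b a)`_k != 0 -> (0 < k < p_ b)%N) ->
  (forall b k, (0 < k < p_ b)%N -> L b (u + k%:Z) = L' b (u + k%:Z)) ->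
  log_monomial M a u L = log_monomial M a u L'.
Proof.
move=> Ms LL'; apply: eq_bigr => b _; apply: eq_bigr => k _.
by have [->|/Ms/LL' ->//] := eqVneq (M b a)`_k 0; rewrite !mul0r.
Qed.

Lemma N_supp_neq0 b a k :
  ((Nplus N b a)`_k != 0 -> (0 < k < p_ b)%N) /\
  ((Nminus N b a)`_k != 0 -> (0 < k < p_ b)%N).
Proof. by split; apply: contraNT => /N_supp H; rewrite (H a).1 || rewrite (H a).2. Qed.

Lemma log_solution_exists : exists L, log_solution L /\
  forall b (j : nat), (j < p_ b)%N -> L b j%:Z = 0.
Proof.
(* A variable at a later time may be created earlier, hence the recursion is   *)
(* on the time of creation, [u - p_ b].                                        *)
pose m (bu : 'I_r * int) : nat :=
  if bu.2 is Posz u then (if (u < p_ bu.1)%N then 0 else (u - p_ bu.1).+1)%N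
  else absz bu.2.
pose rhs (f : 'I_r * int -> R) a u :=
  log_sum_exp (log_monomial (Nplus N) a u (fun b v => f (b, v)))
    (log_monomial (Nminus N) a u (fun b v => f (b, v))).
pose prev b := (sigma^-1)%g b.
pose rule (f : 'I_r * int -> R) (bu : 'I_r * int) : R :=
  if bu.2 is Posz u then
    if (u < p_ bu.1)%N then 0
    else rhs f (prev bu.1) (u - p_ bu.1)%N%:Z - f (prev bu.1, (u - p_ bu.1)%N%:Z)
  else rhs f bu.1 bu.2 - f (sigma bu.1, bu.2 + (p_ (sigma bu.1))%:Z).
have rhs_local f g a u : (forall b (k : nat), (0 < k < p_ b)%N ->
    f (b, u + k%:Z) = g (b, u + k%:Z)) -> rhs f a u = rhs g a u.
  move=> fg; rewrite /rhs; congr log_sum_exp; apply: log_monomial_local => // b k.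
    exact: (N_supp_neq0 _ _ _).1.
  exact: (N_supp_neq0 _ _ _).2.
have [f|f fE] := @measure_recursion _ R m 0 rule.
  move=> g [b [u|u]] H; rewrite /rule /=.
    case: ltnP => // pu; congr (_ - _).
      apply: rhs_local => c k /andP[k0 kc]; apply: H.
      rewrite /m /= [(u < _)%N]ltnNge pu /=.
      by case: (ltnP (u - p_ b + k) (p_ c)) => //; lia.
    apply: H; rewrite /m /= [(u < _)%N]ltnNge pu /=; have := p_gt0 (prev b).
    by case: (ltnP (u - p_ b) (p_ (prev b))) => //; lia.
  congr (_ - _).
    apply: rhs_local => c k /andP[k0 kc]; apply: H; rewrite /m /=.
    by case E : (_ + _) => [v|v] //=; last lia; case: (ltnP v (p_ c)) => //; lia.
  apply: H; rewrite /m /=; have := p_gt0 (sigma b).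
  by case E : (_ + _) => [v|v] //=; last lia; case: (ltnP v (p_ (sigma b))) => //; lia.
exists (fun b v => f (b, v)); split; last first.
  by move=> b j jp; rewrite fE /rule /= jp.
move=> a [u|u].
  rewrite [X in _ + X]fE /rule /= ltnNge leq_addl /= addnK /prev permK.
  by rewrite addrC subrK.
by rewrite [X in X + _]fE /rule subrK.
Qed.

Lemma log_solution_bounded (alpha : T_datum r) L :
  T_triple alpha = N -> finite_type alpha -> log_solution L ->
  exists C, forall a u, L a u <= C.
Proof.
move=> aN fin sol.
have [f fT] := Tfree_exp_eval L.
have fM M a u : f (Tmonomial M a u) = expR (log_monomial M a u L).
  rewrite /Tmonomial rmorph_prod expR_sum; apply: eq_bigr => b _.
  rewrite rmorph_prod expR_sum; apply: eq_bigr => k _.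
  by rewrite rmorphXn /= (fT _ _).1 expRM_natl.
have [||C LC] := @finite_type_bounded R r alpha (fun a u => expR (L a u)) f fin.
- by move=> a u; exact: (fT a u).1.
- move=> y [a [u [->|->]]].
    rewrite rmorphB rmorphM.
    transitivity (expR (L a u) * expR (- L a u) - 1).
      by congr (_ * _ - _); [case: (fT a u) | case: (fT a u) | exact: rmorph1].
    by rewrite -expRD subrr expR0 subrr.
  rewrite aN rmorphB rmorphD.
  transitivity (expR (log_monomial (N0 N) a u L)
    - (expR (log_monomial (Nplus N) a u L) + expR (log_monomial (Nminus N) a u L))).
    by congr (_ - (_ + _)); apply: fM.
  by rewrite log_monomial_N0 sol expR_log_sum_exp subrr.
(* The bound is on $e^L$, and $L\le 1+L\le e^L$. *)
exists C => a u; apply: le_trans (LC a u).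
by apply: le_trans (expR_ge1Dx _); rewrite lerDr.
Qed.

End TSystemSolution.

(** * Events and the symplectic relation *)

Definition reflect_poly (w : nat) (q : {poly int}) : {poly int} :=
  \poly_(k < w.+1) q`_(w - k).

Lemma tofracpoly_reflect w (q : {poly int}) : (size q <= w.+1)%N ->
  tofracpoly (reflect_poly w q) = tofracpoly 'X ^+ w * subst_zinv q.
Proof.
move=> sq; have X0 : tofracpoly 'X != 0 by rewrite tofrac_eq0 polyX_eq0.
rewrite /subst_zinv (@horner_coef_wide _ w.+1); last first.
  by rewrite (leq_trans (size_poly _ _)).
rewrite /reflect_poly poly_def /tofracpoly rmorph_sum mulr_sumr (reindex_inj rev_ord_inj) /=.
apply: eq_bigr => k _; rewrite subSS subKn; last by rewrite -ltnS.
rewrite coef_map_id0 ?rmorph0 // -mul_polyC rmorphM rmorphXn /=.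
rewrite mulrCA; congr (_ * _).
  by rewrite -[in LHS](intz q`_k) !rmorph_int.
by rewrite exprVn -exprB // -ltnS.
Qed.

(** Multiplying one entry of the matrix identity by $z^w$ clears the negative powers in the daggers:
    [reflect_poly w q] is $z^wq(z^{-1})$. *)
Lemma symplectic_poly n (Ap Am : 'M[{poly int}]_n) (D : 'M[int]_n) b' b w :
  is_diag_mx D ->
  (forall c, size (Ap b c) <= w.+1)%N -> (forall c, size (Am b c) <= w.+1)%N ->
  fracmx Ap *m fracmx (constmx D) *m dagger Am =
    fracmx Am *m fracmx (constmx D) *m dagger Ap ->
  \sum_c Ap b' c * (D c c)%:P * reflect_poly w (Am b c) =
  \sum_c Am b' c * (D c c)%:P * reflect_poly w (Ap b c).
Proof.
move=> /is_diag_mxP dD sp sm /matrixP/(_ b' b).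
have entry (A A' : 'M[{poly int}]_n) : (forall c, size (A' b c) <= w.+1)%N ->
    tofracpoly (\sum_c A b' c * (D c c)%:P * reflect_poly w (A' b c)) =
    tofracpoly 'X ^+ w * (fracmx A *m fracmx (constmx D) *m dagger A') b' b.
  move=> s'; rewrite /tofracpoly rmorph_sum !mxE mulr_sumr; apply: eq_bigr => c _.
  rewrite rmorphM [X in _ * X](tofracpoly_reflect (s' c)) mulrCA !mxE.
  congr (_ * (_ * _)); rewrite (bigD1 c) //= !mxE rmorphM big1 ?addr0 // => d dc.
  by rewrite !mxE (dD _ _ dc) /tofracpoly rmorph0 mulr0.
move=> /(congr1 (fun x => tofracpoly 'X ^+ w * x)); rewrite -!entry //.
by move/eqP; rewrite tofrac_eq => /eqP.
Qed.

Section EventOrder.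
Variable r : nat.

(** Variables are numbered by time first; the order among variables of equal time is immaterial. The
    size [r.+1] keeps division and remainder meaningful. *)
Definition event (a : 'I_r.+1) (u : nat) : nat := (u * r.+1 + a)%N.

Definition event_node (e : nat) : 'I_r.+1 := inord (e %% r.+1).

Definition event_time (e : nat) : nat := (e %/ r.+1)%N.

Lemma eventK a u : event_node (event a u) = a.
Proof. by apply: val_inj; rewrite /event_node /= inordK ?ltn_pmod // modnMDl modn_small. Qed.

Lemma event_timeK a u : event_time (event a u) = u.
Proof. by rewrite /event_time divnMDl // divn_small // addn0. Qed.

Lemma event_nodeK e : event (event_node e) (event_time e) = e.
Proof. by rewrite /event inordK ?ltn_pmod // -divn_eq. Qed.

Lemma event_ltn e e' : (event_time e < event_time e')%N -> (e < e')%N.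
Proof. by rewrite ltnNge => h; rewrite ltnNge; apply: contra h; apply: leq_div2r. Qed.

Lemma big_event (V : nmodType) n (G : 'I_r.+1 -> nat -> V) :
  \sum_c \sum_(u < n) G c u =
  \sum_(0 <= e < n * r.+1) G (event_node e) (event_time e).
Proof.
rewrite exchange_big; elim: n => [|n IH]; first by rewrite big_ord0 mul0n big_geq.
rewrite mulSnr big_ord_recr /= IH [RHS](big_cat_nat (n := (n * r.+1)%N)) ?leq_addr //=.
congr (_ + _); rewrite -[X in _ = \sum_(X <= _ < _) _]add0n big_addn addKn big_mkord.
apply: eq_bigr => c _; rewrite addnC -/(event c n).
by rewrite eventK event_timeK.
Qed.

End EventOrder.

Lemma sum_nat_supp (V : nmodType) (F : nat -> V) a b a' b' :
  (forall k, F k != 0 -> (a <= k < b)%N && (a' <= k < b')%N) ->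
  \sum_(a <= k < b) F k = \sum_(a' <= k < b') F k.
Proof.
move=> H; pose m := maxn b b'.
have E x y : (y <= m)%N -> (forall k, F k != 0 -> (x <= k < y)%N) ->
    \sum_(x <= k < y) F k = \sum_(0 <= k < m) F k.
  move=> ym Fxy; rewrite (big_nat_widen _ _ _ _ _ ym) (big_nat_widenl _ _ _ _ _ (leq0n x)).
  rewrite big_mkcond; apply: eq_bigr => k _; case: ifP => // /negbT.
  by have [->|/Fxy/andP[-> ->]] := eqVneq (F k) 0.
by rewrite !E ?leq_maxl ?leq_maxr // => k /H/andP[].
Qed.

Lemma reindex_supp (V : nmodType) (A : finType) (f f' : A -> nat) (F : nat -> V) :
  injective f -> injective f' ->
  (forall e, F e != 0 -> (exists x, f x = e) /\ (exists x, f' x = e)) ->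
  \sum_x F (f x) = \sum_x F (f' x).
Proof.
move=> fI f'I H.
rewrite -(big_map f xpredT F) -(big_map f' xpredT F).
have E s : \sum_(e <- s) F e = \sum_(e <- [seq e <- s | F e != 0]) F e.
  by rewrite big_filter [RHS]big_mkcond; apply: eq_bigr => e _; case: eqP.
rewrite E [RHS]E; apply: perm_big; apply: uniq_perm.
- by rewrite filter_uniq // map_inj_uniq // index_enum_uniq.
- by rewrite filter_uniq // map_inj_uniq // index_enum_uniq.
move=> e; rewrite !mem_filter; case: (boolP (F e != 0)) => //= /H[[x <-] [x' xx']].
by rewrite map_f ?mem_index_enum // -xx' map_f ?mem_index_enum.
Qed.

Section DatumChains.
Variables (R : realType) (r : nat) (N : N_triple r.+1).
Variables (sigma : 'S_r.+1) (p_ : 'I_r.+1 -> nat) (D : 'M[int]_r.+1).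
Variables Mplus Mminus : 'M[{poly int}]_r.+1.
Hypothesis p_gt0 : forall a, (0 < p_ a)%N.
Hypothesis N0E : forall a b k, (N0 N a b)`_k =
  (a == b)%:R * (k == 0%N)%:R + (a == sigma b)%:R * (k == p_ a)%:R.
Hypothesis N_ge0 : forall a b k, 0 <= (Nplus N a b)`_k /\ 0 <= (Nminus N a b)`_k.
Hypothesis N_supp : forall a b k, ~~ (0 < k < p_ a)%N ->
  (Nplus N a b)`_k = 0 /\ (Nminus N a b)`_k = 0.
Hypothesis N_disj : forall a b k, (Nplus N a b)`_k * (Nminus N a b)`_k = 0.
Hypothesis D_diag : is_diag_mx D.
Hypothesis D_gt0 : forall a, 0 < D a a.
Hypothesis D_sigma : forall a, D (sigma a) (sigma a) = D a a.
Hypothesis MplusE : forall a b k, (Mplus a b)`_k * D a a = (Nplus N a b)`_k * D b b.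
Hypothesis MminusE : forall a b k, (Mminus a b)`_k * D a a = (Nminus N a b)`_k * D b b.
Let Ap := N0 N - Nplus N.
Let Am := N0 N - Nminus N.
Hypothesis ApDAm : fracmx Ap *m fracmx (constmx D) *m dagger Am =
  fracmx Am *m fracmx (constmx D) *m dagger Ap.

Definition next_event (e : nat) : nat :=
  event (sigma (event_node r e)) (event_time r e + p_ (sigma (event_node r e))).

Definition initial_event (x : {b : 'I_r.+1 & 'I_(p_ b)}) : nat :=
  event (tag x) (tagged x).

(** The subtraction is truncated. For $N_\pm$ this is harmless, since a nonpositive delay then reads
    the constant coefficient, which is zero. *)
Let coeff (M : 'M[{poly int}]_r.+1) (e k : nat) : int :=
  (M (event_node r e) (event_node r k))`_(event_time r e - event_time r k).

Let node_next e : event_node r (next_event e) = sigma (event_node r e).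
Proof. exact: eventK. Qed.

Let time_next e :
  event_time r (next_event e) = (event_time r e + p_ (sigma (event_node r e)))%N.
Proof. exact: event_timeK. Qed.

Let event_inj e e' :
  event_node r e = event_node r e' -> event_time r e = event_time r e' -> e = e'.
Proof. by move=> en et; rewrite -(event_nodeK r e) -(event_nodeK r e') en et. Qed.

Lemma next_event_gt e : (e < next_event e)%N.
Proof. by apply: (@event_ltn r); rewrite time_next -{1}[event_time r e]addn0 ltn_add2l. Qed.

Lemma next_event_inj : injective next_event.
Proof.
move=> e e' E; have := congr1 (event_node r) E; rewrite !node_next => /perm_inj en.
by apply: event_inj => //; have := congr1 (event_time r) E; rewrite !time_next en => /addIn.
Qed.

Lemma initial_event_inj : injective initial_event.
Proof.
move=> [a i] [b j] E; have := congr1 (event_node r) E; rewrite !eventK /= => ab.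
have := congr1 (event_time r) E; rewrite !event_timeK /=.
by case: b / ab j {E} => j /val_inj ->.
Qed.

Lemma initial_event_neq x k : initial_event x <> next_event k.
Proof.
case: x => a i E; have := congr1 (event_node r) E; rewrite node_next eventK /= => ea.
have := congr1 (event_time r) E; rewrite time_next event_timeK /= -ea.
by have := ltn_ord i; lia.
Qed.

Lemma event_cover e :
  (exists x, e = initial_event x) \/ (exists k, e = next_event k).
Proof.
have [lt|le] := ltnP (event_time r e) (p_ (event_node r e)).
  left; exists (Tagged (fun b => 'I_(p_ b)) (Ordinal lt)).
  by rewrite /initial_event /= event_nodeK.
right; exists (event ((sigma^-1)%g (event_node r e)) (event_time r e - p_ (event_node r e))).
by rewrite /next_event eventK event_timeK permKV subnK // event_nodeK.
Qed.

Let node_supported (M : 'M[{poly int}]_r.+1) : Prop :=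
  forall a b k, ~~ (0 < k < p_ a)%N -> (M a b)`_k = 0.

Let coeff_supp M : node_supported M ->
  forall e k, coeff M e k != 0 -> (k < e)%N /\ forall j, e = next_event j -> (j < k)%N.
Proof.
move=> Ms e k nz.
have /andP[t0 tp] : (0 < event_time r e - event_time r k < p_ (event_node r e))%N.
  by apply: contraNT nz => /Ms e0; rewrite /coeff e0.
split=> [|j ej]; apply: (@event_ltn r); first lia.
by move: tp; rewrite ej node_next time_next; lia.
Qed.

Let NpS : node_supported (Nplus N).
Proof. by move=> a b k /(N_supp b)[]. Qed.

Let NmS : node_supported (Nminus N).
Proof. by move=> a b k /(N_supp b)[]. Qed.

(** This replaces [coeff (N0 N)], for which truncation would read the constant coefficient $1$ when
    [x] is earlier than [k] at the same node. *)
Let coeff0 (x k : nat) : int := (x == k)%:R + (x == next_event k)%:R.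

Let coeff0E x k : (event_time r k <= event_time r x)%N -> coeff (N0 N) x k = coeff0 x k.
Proof.
move=> le; rewrite /coeff N0E /coeff0 -!natrM !mulnb; congr (_%:R + _%:R).
  congr nat_of_bool; apply/andP/eqP => [[/eqP en /eqP et]|->]; last by rewrite subnn.
  by apply: event_inj => //; lia.
congr nat_of_bool; apply/andP/eqP => [[/eqP en /eqP et]|->].
  by apply: event_inj; rewrite ?node_next // time_next -en; lia.
by rewrite node_next time_next addKn.
Qed.

Let coeff_late M x k : node_supported M ->
  (event_time r x < event_time r k)%N -> coeff0 x k - coeff M x k = 0.
Proof.
move=> Ms lt; rewrite /coeff Ms ?subr0; last by rewrite (eqnP (ltnW lt)).
rewrite /coeff0; case: eqP => [xk|_]; first by rewrite xk ltnn in lt.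
case: eqP => [xk|_]; last by rewrite addr0.
by move: lt; rewrite xk time_next; lia.
Qed.

Let size_A M b c w : node_supported M ->
  (p_ b <= w)%N -> (size ((N0 N - M)%R b c) <= w.+1)%N.
Proof.
move=> Ms pw; apply/leq_sizeP => k wk; rewrite !mxE coefB Ms; last by lia.
rewrite N0E (gtn_eqF (leq_ltn_trans pw wk)) (gtn_eqF (leq_ltn_trans (leq0n _) wk)).
by rewrite !mulr0.
Qed.

Let weight k := D (event_node r k) (event_node r k).

Let sum_delta n i (F : nat -> int) : (i < n)%N ->
  \sum_(0 <= k < n) (k == i)%:R * F k = F i.
Proof. by move=> lt_in; rewrite big_mkord; apply: sum_ord_delta. Qed.

(** Both sides are the coefficient of $z^w$, with $w$ replaced by the time of [x], in
    [symplectic_poly] reflected at the time of [y]. A node and a power of $z$ together form an event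
    [k]. *)
Let event_symplectic_sum x y n : n = ((event_time r x).+1 * r.+1)%N ->
  (p_ (event_node r y) <= event_time r y)%N ->
  \sum_(0 <= k < n) ((coeff0 x k - coeff (Nplus N) x k) * weight k
    * (coeff0 y k - coeff (Nminus N) y k)) =
  \sum_(0 <= k < n) ((coeff0 x k - coeff (Nminus N) x k) * weight k
    * (coeff0 y k - coeff (Nplus N) y k)).
Proof.
move=> nE py.
have H := @symplectic_poly _ Ap Am D (event_node r x) (event_node r y) (event_time r y)
  D_diag (fun c => size_A c NpS py) (fun c => size_A c NmS py) ApDAm.
have := congr1 (fun q : {poly int} => q`_(event_time r x)) H; rewrite !coef_sum.
have E M M' : node_supported M ->
    node_supported M' ->
    \sum_c ((N0 N - M) (event_node r x) c * (D c c)%:P *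
      reflect_poly (event_time r y) ((N0 N - M') (event_node r y) c))`_(event_time r x) =
    \sum_(0 <= k < n) ((coeff0 x k - coeff M x k) * weight k
      * (coeff0 y k - coeff M' y k)).
  move=> Ms Ms'; rewrite nE.
  pose G c u := ((N0 N - M) (event_node r x) c)`_(event_time r x - u) * D c c *
    (reflect_poly (event_time r y) ((N0 N - M') (event_node r y) c))`_u.
  transitivity (\sum_c \sum_(u < (event_time r x).+1) G c u).
    by apply: eq_bigr => c _; rewrite coefMr; apply: eq_bigr => u _; rewrite coefMC.
  rewrite big_event; apply: eq_big_nat => k /andP[_ kn].
  have kx : (event_time r k <= event_time r x)%N by rewrite -ltnS ltn_divLR.
  rewrite /G /reflect_poly coef_poly; congr (_ * _ * _).
    by rewrite !mxE coefB -coeff0E.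
  rewrite ltnS; case: leqP => ky; last by rewrite coeff_late.
  by rewrite !mxE coefB -coeff0E.
by rewrite !E.
Qed.

Lemma event_symplectic e e' :
  (e < e')%N -> (forall j, e' = next_event j -> (j < e)%N) ->
  coeff (Nplus N) e' (next_event e) - coeff (Nminus N) e' (next_event e)
    + (coeff (Nplus N) e' e - coeff (Nminus N) e' e)
    - (coeff Mplus (next_event e) e' - coeff Mminus (next_event e) e') =
  \sum_(e.+1 <= k < next_event e) (coeff (Nplus N) e' k * coeff Mminus (next_event e) k
    - coeff (Nminus N) e' k * coeff Mplus (next_event e) k).
Proof.
move=> ee' e'prev; set x := e'; set y := next_event e.
pose n := ((event_time r x).+1 * r.+1)%N.
have xn : (x < n)%N by rewrite /n -ltn_divLR.
have y_p : (p_ (event_node r y) <= event_time r y)%N.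
  by rewrite /y node_next time_next leq_addl.
have S := event_symplectic_sum (erefl n) y_p.
have suppy M : node_supported M ->
    forall k, coeff M y k != 0 -> (e < k < y)%N.
  by move=> Ms k /(coeff_supp Ms)[-> /(_ e erefl) ->].
have suppx M : node_supported M ->
    forall k, coeff M x k != 0 -> (k < x)%N.
  by move=> Ms k /(coeff_supp Ms)[].
have scale (M M' : 'M[{poly int}]_r.+1) k :
    (forall a b k, (M' a b)`_k * D a a = (M a b)`_k * D b b) ->
    coeff M y k * weight k = coeff M' y k * weight y by move=> MM'; rewrite /coeff MM'.
have wy : weight y = weight e by rewrite /weight node_next D_sigma.
pose d k := coeff (Nplus N) y k - coeff (Nminus N) y k.
pose c k := coeff (Nplus N) x k - coeff (Nminus N) x k.
pose K k := coeff (Nplus N) x k * coeff (Nminus N) y k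
  - coeff (Nminus N) x k * coeff (Nplus N) y k.
have d_supp k : d k != 0 -> (e < k < y)%N.
  rewrite /d; have [->|/suppy->//] := eqVneq (coeff (Nplus N) y k) 0.
  by rewrite sub0r oppr_eq0 => /suppy; apply.
have c_supp k : c k != 0 -> (k < x)%N.
  rewrite /c; have [->|/suppx->//] := eqVneq (coeff (Nplus N) x k) 0.
  by rewrite sub0r oppr_eq0 => /suppx; apply.
(* On subtracting the two sides of [S], the products of two [coeff0] cancel; the deltas of [coeff0]
   isolate the events [x], [y] and [e]. *)
have S0 : \sum_(0 <= k < n) ((k == x)%:R * (weight k * d k)
    - ((k == y)%:R * (weight k * c k) + (k == e)%:R * (weight k * c k)) + K k * weight k) = 0.
  apply/eqP; rewrite -(inj_eq (addrI (\sum_(0 <= k < n) ((coeff0 x k - coeff (Nminus N) x k)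
    * weight k * (coeff0 y k - coeff (Nplus N) y k))))) addr0 -[eqbRHS]S -big_split /=.
  apply/eqP/eq_big_nat => k _.
  (* The predecessor of [x] precedes [e], where [d] vanishes, so the second delta of [coeff0 x]
     drops out. *)
  have e1 : (x == next_event k)%:R * d k = 0.
    case: eqP => [/e'prev ke|_]; last by rewrite mul0r.
    have [->|/d_supp/andP[ek _]] := eqVneq (d k) 0; first by rewrite mulr0.
    by rewrite ltnNge (ltnW ke) in ek.
  have e2 : (y == next_event k) = (k == e).
    by rewrite /y (inj_eq next_event_inj) eq_sym.
  rewrite /coeff0 e2 (eq_sym x k) (eq_sym y k).
  have e3 : (x == next_event k)%:R * d k * weight k = 0 by rewrite e1 mul0r.
  by rewrite -[LHS]addr0 -[X in _ + X = _]e3 /K /d /c; ring.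
have wy0 : weight y != 0 by rewrite gt_eqF ?D_gt0.
have Y : \sum_(0 <= k < n) (k == y)%:R * (weight k * c k) = weight y * c y.
  have [yn|ny] := ltnP y n; first exact: (sum_delta (fun k => weight k * c k)).
  have -> : c y = 0.
    apply/eqP/negPn/negP => /c_supp yx.
    by have := leq_ltn_trans ny (ltn_trans yx xn); rewrite ltnn.
  rewrite mulr0 big_nat big1 // => k /andP[_ kn].
  by rewrite (ltn_eqF (leq_trans kn ny)) mul0r.
pose K' k := coeff (Nplus N) x k * coeff Mminus y k - coeff (Nminus N) x k * coeff Mplus y k.
have KE k : K k * weight k = K' k * weight y.
  by rewrite !mulrBl -!mulrA !(scale _ _ _ MplusE) !(scale _ _ _ MminusE).
have K'_supp k : K' k != 0 -> (0 <= k < n)%N && (e.+1 <= k < y)%N.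
  move=> nz; have [ek|/negPf ek] := boolP (e < k < y)%N.
    rewrite andbT leq0n /=; apply: (ltn_trans _ xn).
    have [px|/suppx->//] := eqVneq (coeff (Nplus N) x k) 0.
    have [mx|/suppx->//] := eqVneq (coeff (Nminus N) x k) 0.
    by rewrite /K' px mx !mul0r subrr eqxx in nz.
  have zero (M M' : 'M[{poly int}]_r.+1) : node_supported M ->
      (forall a b k, (M' a b)`_k * D a a = (M a b)`_k * D b b) -> coeff M' y k = 0.
    move=> Ms MM'; apply: (mulIf wy0); rewrite -(scale _ _ _ MM') mul0r.
    have [->|/(suppy _ Ms)] := eqVneq (coeff M y k) 0; first by rewrite mul0r.
    by rewrite ek.
  by rewrite /K' (zero _ _ NmS MminusE) (zero _ _ NpS MplusE) !mulr0 subrr eqxx in nz.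
move: S0; rewrite big_split sumrB big_split /= Y.
rewrite (sum_delta (fun k => weight k * d k)) //.
rewrite (sum_delta (fun k => weight k * c k)); last exact: ltn_trans xn.
under [X in _ + X = _]eq_bigr do rewrite KE.
rewrite -mulr_suml (sum_nat_supp K'_supp) -wy => S0.
apply: (mulIf wy0); apply/eqP; rewrite -subr_eq0 -oppr_eq0 -[eqbRHS]S0.
have -> : weight x * d x = (coeff Mplus y x - coeff Mminus y x) * weight y.
  by rewrite mulrC mulrBl (scale _ _ _ MplusE) (scale _ _ _ MminusE) -mulrBl.
rewrite /c; apply/eqP.
ring.
Qed.

Lemma log_solution_ge0 (L : 'I_r.+1 -> int -> R) :
  log_solution N sigma p_ L -> (forall b (j : nat), (j < p_ b)%N -> L b j%:Z = 0) ->
  forall a (u : nat), 0 <= L a u%:Z.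
Proof.
move=> sol L0 a u.
pose Lc e := L (event_node r e) (event_time r e)%:Z.
suff Lc_ge0 : forall e, 0 <= Lc e by have := Lc_ge0 (event a u); rewrite /Lc eventK event_timeK.
have rep_onto := chain_rep_onto event_cover next_event_gt.
have rep_inj := chain_rep_inj initial_event_inj next_event_inj initial_event_neq.
have NpC := coeff_supp NpS; have NmC := coeff_supp NmS.
have time_inj n : injective (fun x : {b & 'I_(p_ b)} =>
    event (tag x) (event_time r n + tagged x)).
  move=> [b i] [c j] /= E; have := congr1 (event_node r) E; rewrite !eventK /= => bc.
  have := congr1 (event_time r) E; rewrite !event_timeK /= => /addnI.
  by case: c / bc j {E} => j /val_inj ->.
(* A sum over nodes and delays becomes a sum over the current cluster; both index sets contain every
   event with nonzero exponent. *)
have sumE M n : node_supported M -> (forall b c k, 0 <= (M b c)`_k) ->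
    log_monomial M (event_node r n) (event_time r n)%:Z L =
    \sum_x (coeff M (chain_rep initial_event next_event n x) n)%:~R
      * Lc (chain_rep initial_event next_event n x).
  move=> Ms M0; rewrite (@log_monomialE _ _ _ _ _ _ p_) // => [|b k pk]; last first.
    by apply: Ms; rewrite [(k < _)%N]ltnNge pk andbF.
  rewrite sig_big_dep /=.
  pose F e : R := (coeff M e n)%:~R * Lc e.
  rewrite -[RHS]/(\sum_x F (chain_rep initial_event next_event n x)).
  rewrite -(reindex_supp (F := F) (time_inj n) (@rep_inj n)).
    by apply: eq_bigr => -[b k] _ /=; rewrite /F /coeff /Lc !eventK !event_timeK addKn PoszD.
  move=> e; rewrite /F; have [->|nz _] := eqVneq (coeff M e n) 0; first by rewrite mul0r eqxx.
  have [ne en] := coeff_supp Ms nz; split; last by apply: rep_onto => //; apply: ltnW.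
  have /andP[t0 tp] : (0 < event_time r e - event_time r n < p_ (event_node r e))%N.
    by apply: contraNT nz => /Ms e0; rewrite /coeff e0.
  exists (Tagged (fun b => 'I_(p_ b)) (Ordinal tp)).
  by rewrite /= subnKC ?event_nodeK //; lia.
apply: (chain_log_ge0 initial_event_inj next_event_inj initial_event_neq event_cover
  next_event_gt (D := weight) (np := coeff (Nplus N)) (nm := coeff (Nminus N))
  (np' := coeff Mplus) (nm' := coeff Mminus)).
- by move=> k; apply: D_gt0.
- by move=> k; rewrite /weight node_next D_sigma.
- by move=> e k; case: (N_ge0 (event_node r e) (event_node r k) (event_time r e - event_time r k)%N).
- by move=> e k; case: (N_ge0 (event_node r e) (event_node r k) (event_time r e - event_time r k)%N).
- by move=> e k; apply: N_disj.
- by move=> e k; apply: MplusE.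
- by move=> e k; apply: MminusE.
- exact: NpC.
- exact: NmC.
- exact: event_symplectic.
- by move=> [b k]; rewrite /Lc /initial_event /= eventK event_timeK; apply: L0.
move=> n; rewrite -(sumE _ _ NpS) => [|b c k]; last by case: (N_ge0 b c k).
rewrite -(sumE _ _ NmS) => [|b c k]; last by case: (N_ge0 b c k).
by rewrite -sol /Lc node_next time_next PoszD.
Qed.

End DatumChains.

(** * Averaging *)

Lemma mulmx_diag_entry (K : pzRingType) n (A X : 'M[K]_n) a b : is_diag_mx X ->
  (A *m X) a b = A a b * X b b /\ (X *m A) a b = X a a * A a b.
Proof.
move=> /is_diag_mxP dX; rewrite !mxE (bigD1 b) //= [X in _ /\ X = _](bigD1 a) //=.
by rewrite !big1 ?addr0 // => c ca; rewrite dX ?mulr0 ?mul0r // eq_sym.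
Qed.

Lemma constmx_diag n (D : 'M[int]_n) : is_diag_mx D -> is_diag_mx (constmx D).
Proof. by move=> /is_diag_mxP dD; apply/is_diag_mxP => i j ij; rewrite mxE dD. Qed.

Lemma fracmx_diag n (A : 'M[{poly int}]_n) : is_diag_mx A -> is_diag_mx (fracmx A).
Proof.
move=> /is_diag_mxP dA; apply/is_diag_mxP => i j ij.
by rewrite mxE dA // /tofracpoly rmorph0.
Qed.

Lemma fracmx_diag_unit n (D : 'M[int]_n) :
  is_diag_mx D -> (forall a, 0 < D a a) -> fracmx (constmx D) \in unitmx.
Proof.
move=> dD D0; rewrite unitmxE unitfE det_trig ?is_diag_mx_is_trig ?fracmx_diag ?constmx_diag //.
by apply/prodf_neq0 => a _; rewrite !mxE tofrac_eq0 polyC_eq0 gt_eqF.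
Qed.

Lemma diag_conj_coef n (D : 'M[int]_n) (A M : 'M[{poly int}]_n) :
  is_diag_mx D -> (forall a, 0 < D a a) ->
  invmx (fracmx (constmx D)) *m fracmx A *m fracmx (constmx D) = fracmx M ->
  forall a b k, (M a b)`_k * D a a = (A a b)`_k * D b b.
Proof.
move=> dD D0 E a b k; have U := fracmx_diag_unit dD D0.
have dF := fracmx_diag (constmx_diag dD).
have : fracmx A *m fracmx (constmx D) = fracmx (constmx D) *m fracmx M.
  by rewrite -E -!mulmxA mulKVmx.
move=> /matrixP/(_ a b); rewrite (mulmx_diag_entry _ _ _ dF).1 (mulmx_diag_entry _ _ _ dF).2.
rewrite !mxE /tofracpoly -!rmorphM => /eqP; rewrite tofrac_eq => /eqP.
by move=> /(congr1 (fun q : {poly int} => q`_k)); rewrite coefMC coefCM => ->; rewrite mulrC.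
Qed.

Lemma diag_commute_coef n (D : 'M[int]_n) (A : 'M[{poly int}]_n) a b k :
  is_diag_mx D -> A *m constmx D = constmx D *m A -> (A a b)`_k = 1 -> D a a = D b b.
Proof.
move=> /constmx_diag dD /matrixP/(_ a b) + Ak.
rewrite (mulmx_diag_entry _ _ _ dD).1 (mulmx_diag_entry _ _ _ dD).2 !mxE.
move=> /(congr1 (fun q : {poly int} => q`_k)).
by rewrite coefMC coefCM Ak mul1r mulr1.
Qed.

Section Averaging.
Variable R : realType.

(** Moving the window by one place exchanges one boundary term for another, a change of at most
    [C]. *)
Lemma shifted_sum_bound (f : nat -> R) C n k : (forall u, 0 <= f u <= C) ->
  `|\sum_(u < n) f (u + k)%N - \sum_(u < n) f u| <= k%:R * C.
Proof.
move=> fC; elim: k => [|k IH].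
  by rewrite mul0r; under eq_bigr do rewrite addn0; rewrite subrr normr0.
have E : \sum_(u < n) f (u + k.+1)%N = \sum_(u < n) f (u + k)%N + f (n + k)%N - f k.
  rewrite -(big_ord_recr n (fun u => f (u + k)%N)) big_ord_recl addrAC add0n subrr add0r.
  by apply: eq_bigr => u _; rewrite addnS.
have -> : \sum_(u < n) f (u + k.+1)%N - \sum_(u < n) f u =
    \sum_(u < n) f (u + k)%N - \sum_(u < n) f u + (f (n + k)%N - f k) by rewrite E; ring.
rewrite -natr1 mulrDl mul1r; apply: le_trans (ler_normD _ _) _; apply: lerD => //.
 have /andP[a0 aC] := fC (n + k)%N; have /andP[b0 bC] := fC k.
by rewrite ler_norml; apply/andP; split; lra.
Qed.

(** Summing the lower bound over [m] times gives [m * d], and evaluating at $z=1$ amounts to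
    ignoring the shifts. The added $1$ makes a nonnegative average strictly positive. *)
Lemma eventually_positive_average n (A : 'M[{poly int}]_n) (B : 'I_n -> nat)
    (L : 'I_n -> nat -> R) (C d : R) :
  (forall a b, (size (A b a) <= B b)%N) -> (forall b u, 0 <= L b u <= C) -> 0 < d ->
  (forall a u, d <= \sum_b \sum_(k < B b) ((A b a)`_k)%:~R * L b (u + k)%N) ->
  exists m0, forall m, (m0 <= m)%N ->
  forall a, 0 < \sum_b ((A b a).[1])%:~R * (1 + \sum_(u < m) L b u).
Proof.
move=> AB LC d_gt0 Ld.
(* The error, independent of [m], made by replacing each shifted sum with [1 + S b]: at most $1+kC$
   for a shift by $k$. *)
pose K a := \sum_b \sum_(k < B b) `|((A b a)`_k)%:~R : R| * (1 + k%:R * C).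
have [n0|n_gt0] := posnP n; first by exists 0 => m _ a; have : (a < 0)%N by rewrite -n0.
have C0 : 0 <= C by have /andP[/le_trans] := LC (Ordinal n_gt0) 0; apply.
have K0 a : 0 <= K a.
  apply: sumr_ge0 => b _; apply: sumr_ge0 => k _.
  by rewrite mulr_ge0 // addr_ge0 // mulr_ge0.
exists (Num.bound ((\sum_a K a) / d)) => m mb a.
have Kd : K a < m%:R * d.
  rewrite -ltr_pdivrMr //; apply: lt_le_trans (_ : (Num.bound ((\sum_a K a) / d))%:R <= _).
    apply: le_lt_trans (archi_boundP _); last by rewrite divr_ge0 ?sumr_ge0 // ltW.
    by rewrite ler_pM2r ?invr_gt0 // (bigD1 a) //= lerDl sumr_ge0.
  by rewrite ler_nat.
pose S b := \sum_(u < m) L b u.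
pose Sk b k := \sum_(u < m) L b (u + k)%N.
have Sd : m%:R * d <= \sum_b \sum_(k < B b) ((A b a)`_k)%:~R * Sk b k.
  have -> : \sum_b \sum_(k < B b) ((A b a)`_k)%:~R * Sk b k =
      \sum_(u < m) \sum_b \sum_(k < B b) ((A b a)`_k)%:~R * L b (u + k)%N.
    rewrite exchange_big; apply: eq_bigr => b _; rewrite exchange_big.
    by apply: eq_bigr => k _; rewrite mulr_sumr.
  rewrite -[m in m%:R]card_ord mulr_natl -sumr_const.
  by apply: ler_sum => u _; apply: Ld.
have diff : \sum_b \sum_(k < B b) ((A b a)`_k)%:~R * Sk b k
    - \sum_b ((A b a).[1])%:~R * (1 + S b) <= K a.
  rewrite -sumrB; apply: ler_sum => b _.
  rewrite (horner_coef_wide _ (AB a b)) rmorph_sum mulr_suml -sumrB.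
  apply: ler_sum => k _; rewrite expr1n mulr1 -mulrBr.
  apply: le_trans (ler_norm _) _; rewrite normrM ler_wpM2l // opprD addrCA.
  apply: le_trans (ler_normD _ _) _; rewrite normrN1 lerD2l.
  exact: shifted_sum_bound.
rewrite -/(S _); lra.
Qed.

(** Since $x\le C$ and $y\ge 0$, one has $e^{x-C}\le e^y$, so $e^x(1+e^{-C})\le e^x+e^y$. *)
Lemma log_sum_exp_gap (x y C : R) : 0 <= y -> log_sum_exp x y <= C ->
  x + ln (1 + expR (- C)) <= log_sum_exp x y.
Proof.
move=> y0 xyC; rewrite -ler_expR expRD expR_log_sum_exp lnK ?posrE ?addr_gt0 ?expR_gt0 //.
rewrite mulrDr mulr1 lerD2l -expRD ler_expR.
suff : x <= C by lra.
apply: le_trans xyC; rewrite -ler_expR expR_log_sum_exp.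
by rewrite lerDl expR_ge0.
Qed.

End Averaging.

Theorem theorem1p4 (R : realType) (r : nat) (alpha : T_datum r) :
  finite_type alpha ->
  exists v : 'cV[R]_r,
    [/\ positive_vec v,
        positive_vec ((at1 R (Aplus alpha))^T *m v)
      & positive_vec ((at1 R (Aminus alpha))^T *m v)].
Proof.
case: r alpha => [|r] alpha fin.
  by exists 0; split; case.
have [[sigma [p_ [p_gt0 N0E N_ge0 N_supp N_disj]]] ApE AmE] := T_tripleP alpha.
set N := T_triple alpha in N0E N_ge0 N_supp N_disj ApE AmE *.
move=> [[D_diag D_gt0] N0D [Mp MpE] [Mm MmE]]; rewrite ApE AmE => ApDAm.
have D_sigma a : Dmx alpha (sigma a) (sigma a) = Dmx alpha a a.
  apply: (diag_commute_coef (k := p_ (sigma a)) D_diag N0D).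
  by rewrite N0E !eqxx (gtn_eqF (p_gt0 _)) mulr0 add0r mulr1.
have MpD := diag_conj_coef D_diag D_gt0 MpE.
have MmD := diag_conj_coef D_diag D_gt0 MmE.
have [L [sol L0]] := log_solution_exists R sigma p_gt0 N_supp.
have [C LC] := log_solution_bounded N0E (erefl N) fin sol.
have L_ge0 := log_solution_ge0 p_gt0 N0E N_ge0 N_supp N_disj D_diag D_gt0 D_sigma
  MpD MmD ApDAm sol L0.
pose B b := (p_ b).+1.
(* The bound is [C + C] because the logarithm of the sum equals a sum of two values of [L]. *)
pose d := ln (1 + expR (- (C + C))).
have d_gt0 : 0 < d by rewrite ln_gt0 // ltrDl expR_gt0.
have mono_ge0 M a (u : nat) : 0 <= log_monomial M a u%:Z L.
  apply: sumr_ge0 => b _; apply: sumr_ge0 => k _.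
  by rewrite mulr_ge0 // -PoszD.
have N0B b a k : (B b <= k)%N -> (N0 N b a)`_k = 0.
  by move=> bk; rewrite N0E (gtn_eqF bk) (gtn_eqF (leq_trans _ bk)) // !mulr0 addr0.
have N0_ge0 b a k : 0 <= (N0 N b a)`_k.
  by rewrite N0E addr_ge0 // mulr_ge0 // ler0n.
have average M : (M = Nplus N \/ M = Nminus N) ->
    exists m0, forall m, (m0 <= m)%N -> forall a,
    0 < \sum_b (((N0 N - M) b a).[1])%:~R * (1 + \sum_(u < m) L b u%:Z).
  move=> MN.
  have M_ge0 b a k : 0 <= (M b a)`_k.
    by case: MN => ->; case: (N_ge0 b a k).
  have MB b a k : (B b <= k)%N -> (M b a)`_k = 0.
    move=> bk; have H : ~~ (0 < k < p_ b)%N by rewrite [(k < _)%N]ltnNge (ltnW bk) andbF.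
    by case: MN => ->; case: (N_supp b a k H).
  apply: (@eventually_positive_average R _ (N0 N - M) B (fun b u => L b u%:Z) C d) => //.
  - move=> a b; apply/leq_sizeP => k bk; rewrite !mxE coefB N0B // MB ?subr0 //.
  - by move=> b u; rewrite L_ge0 LC.
  move=> a u.
  have -> : \sum_b \sum_(k < B b) (((N0 N - M) b a)`_k)%:~R * L b (u + k)%N%:Z =
      L a u%:Z + L (sigma a) (u%:Z + (p_ (sigma a))%:Z) - log_monomial M a u%:Z L.
    rewrite -(log_monomial_N0 N0E).
    rewrite (log_monomialE _ _ (fun b => N0_ge0 b a) (fun b => @N0B b a)).
    rewrite (log_monomialE _ _ (fun b => M_ge0 b a) (fun b => @MB b a)).
    rewrite -sumrB; apply: eq_bigr => b _.
    rewrite -sumrB; apply: eq_bigr => k _.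
    by rewrite !mxE coefB rmorphB mulrBl PoszD.
  rewrite lerBrDl sol.
  have lse_le : log_sum_exp (log_monomial (Nplus N) a u%:Z L)
      (log_monomial (Nminus N) a u%:Z L) <= C + C by rewrite -sol lerD.
  case: MN => ->; first exact: log_sum_exp_gap.
  by rewrite log_sum_expC; apply: log_sum_exp_gap => //; rewrite log_sum_expC.
have [mp Hp] := average _ (or_introl erefl).
have [mm Hm] := average _ (or_intror erefl).
pose m := maxn mp mm.
have entry M a : ((at1 R (N0 N - M))^T *m
    (\col_b (1 + \sum_(u < m) L b u%:Z))) a 0 =
    \sum_b (((N0 N - M) b a).[1])%:~R * (1 + \sum_(u < m) L b u%:Z).
  by rewrite !mxE; apply: eq_bigr => b _; rewrite !mxE.
exists (\col_b (1 + \sum_(u < m) L b u%:Z)); split=> a.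
- by rewrite mxE ltr_wpDr // sumr_ge0.
- by rewrite entry; apply: Hp; apply: leq_maxl.
- by rewrite entry; apply: Hm; apply: leq_maxr.
Qed.
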